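(* Let $U_h,V_h$ (with values in $(\mathbb{V}_h^k)^9$) be any solutions of the discrete variational equation: for all $i,j$ and all $\varphi\in(\mathbb{V}_h^k)^9$, $$\int_{J_j}\int_{I_i}M\,dZ_h\cdot\varphi\,dx\,dy-\int_{J_j}\Big(\int_{I_i}K_1Z_h\cdot\varphi_x\,dx-\big(\widehat{K_1Z_h}\cdot\varphi^-\big)_{i+\frac12,y}+\big(\widehat{K_1Z_h}\cdot\varphi^+\big)_{i-\frac12,y}\Big)dy\,dt$$ $$-\int_{I_i}\Big(\int_{J_j}K_2Z_h\cdot\varphi_y\,dy-\big(\widehat{K_2Z_h}\cdot\varphi^-\big)_{x,j+\frac12}+\big(\widehat{K_2Z_h}\cdot\varphi^+\big)_{x,j-\frac12}\Big)dx\,dt=\int_{J_j}\int_{I_i}\nabla^2S_1\,Z_h\cdot\varphi\,dx\,dy\,dt.$$ Then the following semi-discrete version of the multi-symplectic conservation law holds on every cell $I_i\times J_j$: $$\int_{J_j}\int_{I_i}d(MU_h\cdot V_h)\,dx\,dy-\int_{J_j}\Big(\mathcal{F}_{K_1}(U_h,V_h)_{i+\frac12,y}-\mathcal{F}_{K_1}(U_h,V_h)_{i-\frac12,y}\Big)dy\,dt$$ $$-\int_{I_i}\Big(\mathcal{F}_{K_2}(U_h,V_h)_{x,j+\frac12}-\mathcal{F}_{K_2}(U_h,V_h)_{x,j-\frac12}\Big)dx\,dt=0,$$ where, for $r=1,2$, $$\mathcal{F}_{K_r}(U_h,V_h)=\{K_rU_h\cdot V_h\}-\widehat{K_rU_h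}\cdot\{V_h\}+\widehat{K_rV_h}\cdot\{U_h\}.$$
   Context: A bounded rectangle $I\times J$ is partitioned into cells $I_i\times J_j=[x_{i-\frac12},x_{i+\frac12}]\times[y_{j-\frac12},y_{j+\frac12}]$, $i=1,\dots,N_x$, $j=1,\dots,N_y$. $\mathbb{V}_h^k=\{v:v|_{I_i\times J_j}\in P^k(I_i)\otimes P^k(J_j)\ \forall i,j\}$, with $P^k$ the polynomials of degree at most $k$. At a cell interface, $g^+,g^-$ are the limits from the right (resp. top) and from the left (resp. bottom), $\{g\}=\frac12(g^++g^-)$, $[g]=g^+-g^-$; traces on the boundary of $I\times J$ are defined by periodicity. $d$ is the It\^o differential in time. The two-dimensional stochastic Maxwell equations $-dE+T_x\,dt-S_y\,dt=\lambda_1dW_t$, $dS+E_y\,dt=\lambda_2dW_t$, $dT-E_x\,dt=\lambda_2dW_t$ ($W_t$ a $Q$-Wiener process, $\lambda_1,\lambda_2$ real constants) are rewritten with $u_t=E$, $v_t=S$, $w_t=T$, $P=T-\frac12u_x$, $Q=S+\frac12u_y$, $R=E-\frac12w_x+\frac12v_y$ and $z=(T,S,E,w,v,u,P,Q,R)^T$ as $$M\,dz+K_1z_x\,dt+K_2z_y\,dt=\nabla S_1(z)\,dt+\nabla S_2(z)\,dW_t,$$ $$S_1=PT+QS+RE-\tfrac{T^2+S^2+E^2}{2},\qquad S_2=\lambda_1u-\lambda_2(w+v).$$ The $9\times9$ anti-symmetric matrices $M,K_1,K_2$ have as only non-zero entries: $M_{47}=M_{58}=M_{69}=-1$, $M_{74}=M_{85}=M_{96}=1$;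 $(K_1)_{16}=(K_1)_{34}=-\frac12$, $(K_1)_{43}=(K_1)_{61}=\frac12$; $(K_2)_{26}=(K_2)_{35}=\frac12$, $(K_2)_{53}=(K_2)_{62}=-\frac12$. $\nabla^2S_1$ is the (constant, symmetric) Hessian of $S_1$. The numerical fluxes are, on interfaces $x=x_0$ (constant $x$) and $y=y_0$ (constant $y$) respectively, $$(\widehat{K_1z_h})_{x_0,y}=(K_1\{z_h\}+A_1[z_h])_{x_0,y},\qquad(\widehat{K_2z_h})_{x,y_0}=(K_2\{z_h\}+A_2[z_h])_{x,y_0},$$ where the only non-zero entries of the $9\times9$ matrices $A_1,A_2$ are $(A_1)_{16}=(A_1)_{61}=m_1$, $(A_1)_{34}=(A_1)_{43}=n_1$; $(A_2)_{26}=(A_2)_{62}=m_2$, $(A_2)_{35}=(A_2)_{53}=n_2$, with $m_1,n_1,m_2,n_2\in\mathbb{R}$, $m_1-n_1=\alpha_1$, $m_2-n_2=\alpha_2$, where $\alpha_1,\alpha_2\in\mathbb{R}$ are the flux parameters of the DG method for $(E,S,T)$ (whose fluxes are $\{T_h\}+\alpha_1[T_h]$ and $\{E_h\}-\alpha_1[E_h]$ in the $x$ direction, $\{S_h\}-\alpha_2[S_h]$ and $\{E_h\}+\alpha_2[E_h]$ in the $y$ direction). The discrete variational equation is obtained by applying the exterior derivative to the corresponding DG scheme for $z_h\in(\mathbb{V}_h^k)^9$ (the noise term drops because $S_2$ is linear). *)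

(* Defs.v *)
From HB Require Import structures.
From mathcomp Require Export all_boot all_order all_algebra.
From mathcomp Require Export all_classical all_reals all_analysis.
Export Order.TTheory GRing.Theory Num.Theory numFieldNormedType.Exports.

#[export] Set Implicit Arguments.
#[export] Unset Strict Implicit.
#[export] Unset Printing Implicit Defensive.

Global Open Scope classical_set_scope.
Global Open Scope ring_scope.

(* Cells are numbered from 0: cell number i is [node i, node i.+1], so that
   node i is its left interface and node i.+1 its right interface; the values
   node i for i > ncells are never used. *)
Record grid (R : realType) := Grid {
  ncells : nat;
  node : nat -> R;
  ncells_gt0 : (0 < ncells)%N;
  node_lt : forall i, (i < ncells)%N -> node i < node i.+1 }.

Definition cell (R : realType) (g : grid R) (i : nat) : set R :=
  `[node g i, node g i.+1].

Definition cell_int (R : realType) (g : grid R) (i : nat) : set R :=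
  `]node g i, node g i.+1[.

(* A function of this space is an ordinary function whose values on the
   interfaces are irrelevant: it agrees with an element of the tensor product
   P^k(I_i) (x) P^k(J_j) on the interior of each cell. Requiring agreement on
   closed cells would force continuity across the interfaces. *)
Definition Vh (R : realType) (gx gy : grid R) (k : nat) :
    set (R -> R -> R) :=
  [set v | forall i j, (i < ncells gx)%N -> (j < ncells gy)%N ->
    exists (r : nat) (p q : 'I_r -> {poly R}),
      [/\ (forall l, (size (p l) <= k.+1)%N),
          (forall l, (size (q l) <= k.+1)%N) &
          forall x y, cell_int gx i x -> cell_int gy j y ->
            v x y = \sum_(l < r) (p l).[x] * (q l).[y]]].

Definition Vh9 (R : realType) (gx gy : grid R) (k : nat) :
    set (R -> R -> 'cV[R]_9) :=
  [set v | forall c, Vh gx gy k (fun x y => v x y c 0)].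

Section Interface.
Context {R : realType} (g : grid R).

(* One-sided limits at interface number i, for i = 0, ..., ncells. The
   right limit at the last interface is taken at the first one, and the left
   limit at the first interface is taken at the last one (periodicity). *)
Definition trp (V : normedModType R) (f : R -> V) (i : nat) : V :=
  lim (f x @[x --> (node g (if i == ncells g then 0%N else i))^'+]).

Definition trm (V : normedModType R) (f : R -> V) (i : nat) : V :=
  lim (f x @[x --> (node g (if i == 0%N then ncells g else i))^'-]).

Definition avg (V : normedModType R) (f : R -> V) (i : nat) : V :=
  2^-1 *: (trp f i + trm f i).

Definition jump (V : normedModType R) (f : R -> V) (i : nat) : V :=
  trp f i - trm f i.

Definition dotv (u v : 'cV[R]_9) : R := \sum_c u c 0 * v c 0.

Definition flux (K A : 'M[R]_9) (z : R -> 'cV[R]_9) (i : nat) : 'cV[R]_9 :=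
  K *m avg z i + A *m jump z i.

Definition FK (K A : 'M[R]_9) (u v : R -> 'cV[R]_9) (i : nat) : R :=
  avg (fun x => dotv (K *m u x) (v x) : R^o) i
  - dotv (flux K A u i) (avg v i) + dotv (flux K A v i) (avg u i).

End Interface.

Section Maxwell.
Context {R : realType}.

(* Entry and coordinate numbers a, b, c below run from 1 to 9. *)
Definition unit_mx (a b : nat) : 'M[R]_9 :=
  delta_mx (inord a.-1) (inord b.-1).

Definition coord (z : 'cV[R]_9) (c : nat) : R := z (inord c.-1) 0.

Definition Mmx : 'M[R]_9 :=
  - unit_mx 4 7 - unit_mx 5 8 - unit_mx 6 9
  + unit_mx 7 4 + unit_mx 8 5 + unit_mx 9 6.

Definition K1 : 'M[R]_9 :=
  2^-1 *: (- unit_mx 1 6 - unit_mx 3 4 + unit_mx 4 3 + unit_mx 6 1).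

Definition K2 : 'M[R]_9 :=
  2^-1 *: (unit_mx 2 6 + unit_mx 3 5 - unit_mx 5 3 - unit_mx 6 2).

Definition A1 (m1 n1 : R) : 'M[R]_9 :=
  m1 *: (unit_mx 1 6 + unit_mx 6 1) + n1 *: (unit_mx 3 4 + unit_mx 4 3).

Definition A2 (m2 n2 : R) : 'M[R]_9 :=
  m2 *: (unit_mx 2 6 + unit_mx 6 2) + n2 *: (unit_mx 3 5 + unit_mx 5 3).

(* z = (T, S, E, w, v, u, P, Q, R)^T *)
Definition S1 (z : 'cV[R]_9) : R :=
  let T := coord z 1 in let S := coord z 2 in let E := coord z 3 in
  let P := coord z 7 in let Q := coord z 8 in let Rr := coord z 9 in
  P * T + Q * S + Rr * E - (T ^+ 2 + S ^+ 2 + E ^+ 2) / 2.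

Definition hessian (f : 'cV[R]_9 -> R) (z : 'cV[R]_9) : 'M[R]_9 :=
  \matrix_(a, b)
    'D_(delta_mx a 0) (fun z' => 'D_(delta_mx b 0) (f : _ -> R^o) z' : R^o) z.

(* S1 is quadratic, so that its Hessian is the same at every point. *)
Definition hessS1 : 'M[R]_9 := hessian S1 0.

End Maxwell.

Section Cell.
Context {R : realType} (gx gy : grid R).
Local Notation mu := (@lebesgue_measure R).

Definition cell_integral (f : R -> R -> R) (i j : nat) : R :=
  \int[mu]_(y in cell gy j) \int[mu]_(x in cell gx i) f x y.

(* The dt-terms of the variational equation coming from the x-derivative. *)
Definition x_terms (A : 'M[R]_9) (Z phi : R -> R -> 'cV[R]_9) (i j : nat) : R :=
  \int[mu]_(y in cell gy j)
    (\int[mu]_(x in cell gx i)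
        dotv (K1 *m Z x y) (derive1 (fun x' => phi x' y) x)
     - dotv (flux gx K1 A (fun x => Z x y) i.+1)
            (trm gx (fun x => phi x y) i.+1)
     + dotv (flux gx K1 A (fun x => Z x y) i)
            (trp gx (fun x => phi x y) i)).

Definition y_terms (A : 'M[R]_9) (Z phi : R -> R -> 'cV[R]_9) (i j : nat) : R :=
  \int[mu]_(x in cell gx i)
    (\int[mu]_(y in cell gy j)
        dotv (K2 *m Z x y) (derive1 (fun y' => phi x y') y)
     - dotv (flux gy K2 A (fun y => Z x y) j.+1)
            (trm gy (fun y => phi x y) j.+1)
     + dotv (flux gy K2 A (fun y => Z x y) j)
            (trp gy (fun y => phi x y) j)).

Definition x_flux_balance (A : 'M[R]_9) (U V : R -> R -> 'cV[R]_9)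
    (i j : nat) : R :=
  \int[mu]_(y in cell gy j)
    (FK gx K1 A (fun x => U x y) (fun x => V x y) i.+1
     - FK gx K1 A (fun x => U x y) (fun x => V x y) i).

Definition y_flux_balance (A : 'M[R]_9) (U V : R -> R -> 'cV[R]_9)
    (i j : nat) : R :=
  \int[mu]_(x in cell gx i)
    (FK gy K2 A (fun y => U x y) (fun y => V x y) j.+1
     - FK gy K2 A (fun y => U x y) (fun y => V x y) j).

End Cell.

Section Stochastic.
Context {R : realType} {d : measure_display} {Om : measurableType d}
  (P : probability Om R) (Tf : R).
Local Notation mu := (@lebesgue_measure R).

(* The identity  dX_t = a_t dt  of Ito differentials on [0, Tf]: almost surely,
   a is integrable in time and X_t - X_0 is the integral of a over [0, t]. *)
Definition ito_differential (X a : R -> Om -> R) : Prop :=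
  {ae P, forall w,
    mu.-integrable `[0, Tf] (fun t => (a t w)%:E) /\
    forall t, 0 <= t <= Tf ->
      X t w - X 0 w = \int[mu]_(s in `[0, t]) a s w}.

(* Solutions of the discrete variational equation. The test functions are
   deterministic and independent of time, so that the cell integral of
   M dZ . phi is the differential of the cell integral of M Z . phi. *)
Definition variational_solution (gx gy : grid R) (k : nat) (m1 n1 m2 n2 : R)
    (Z : R -> Om -> R -> R -> 'cV[R]_9) : Prop :=
  (forall t w, 0 <= t <= Tf -> Vh9 gx gy k (Z t w)) /\
  forall i j, (i < ncells gx)%N -> (j < ncells gy)%N ->
  forall phi, Vh9 gx gy k phi ->
    ito_differential
      (fun t w =>
        cell_integral gx gy (fun x y => dotv (Mmx *m Z t w x y) (phi x y)) i j)
      (fun t w =>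
        x_terms gx gy (A1 m1 n1) (Z t w) phi i j
        + y_terms gx gy (A2 m2 n2) (Z t w) phi i j
        + cell_integral gx gy
            (fun x y => dotv (hessS1 *m Z t w x y) (phi x y)) i j).

Definition multisymplectic_conservation (gx gy : grid R) (m1 n1 m2 n2 : R)
    (U V : R -> Om -> R -> R -> 'cV[R]_9) (i j : nat) : Prop :=
  ito_differential
    (fun t w =>
      cell_integral gx gy
        (fun x y => dotv (Mmx *m U t w x y) (V t w x y)) i j)
    (fun t w =>
      x_flux_balance gx gy (A1 m1 n1) (U t w) (V t w) i j
      + y_flux_balance gx gy (A2 m2 n2) (U t w) (V t w) i j).

End Stochastic.

(* Main.v *)
Require Import Defs.
From mathcomp Require Import ring lra measurable_realfun.

(** The balance is the difference of two uses of the variational equation: the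
    one for [U] tested with [V], minus the one for [V] tested with [U].

    In space, integrate by parts on a cell along a line of constant [y] (or
    [x]). As [K] is skew, [K u . v' - K v . u'] is the derivative of [K u . v],
    so that the volume terms leave only boundary values. At each interface
    these combine with the numerical fluxes to the two-point quantity [FK],
    because the flux matrix [A] is symmetric ([interface_minus],
    [interface_plus], [line_terms_skew], [dir_terms_skew]). The Hessian terms
    cancel by symmetry ([scheme_terms_skew]).

    The test functions of the scheme are independent of time, so [V] itself
    cannot be inserted. Instead [U] and [V] are expanded on the cell in a basis
    made of products of [L2]-orthonormal polynomials ([Vh9_expand]). Only
    finitely many basis functions are involved, hence almost every path
    satisfies the equation tested with all of them, and from there on the path
    is fixed and the argument is deterministic.

    In time, write [u], [v] for the columns of moments of [U], [V] against one
    scalar basis function; then [M u] and [M v] are indefinite integrals of the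
    right-hand sides [al], [be] of the scheme, and what is needed is that
    [M u . v] is an indefinite integral of [al . v - be . u]
    ([primitive_bilinear]). The matrix [M] pairs the components 4, 5, 6 with
    7, 8, 9 up to sign, so on these components every moment of a solution is
    plus or minus an indefinite integral, and the product rule for such
    functions applies ([primitiveM]). The components 1, 2, 3 (that is [T], [S],
    [E]) lie in the kernel of [M] and their moments may be irregular in time.
    There the equation reads [al = 0] almost everywhere, and the corresponding
    products vanish almost everywhere; they are measurable because the rows 7,
    8, 9 of the scheme contain no flux and identify the moments of [T], [S],
    [E] with integrable right-hand sides ([scheme_terms_high]). *)

(** * Indefinite integrals in time *)

Section TimeCalculus.
Context {R : realType}.
Local Notation mu := (@lebesgue_measure R).

Lemma ae_neq (c : R) : {ae mu, forall t, t != c}.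
Proof.
exists [set c]; split => //; first by rewrite lebesgue_measure_set1.
by move=> t /= /negP; rewrite negbK => /eqP.
Qed.

Lemma integrable_patch (D : set R) (f : R -> R) : measurable D ->
  mu.-integrable D (EFin \o f) -> mu.-integrable setT (EFin \o (f \_ D)).
Proof.
move=> mD If; rewrite -restrict_EFin.
by apply/integrable_restrict => //; rewrite setTI.
Qed.

Lemma integrable_tensor (f g : R -> R) :
  mu.-integrable setT (EFin \o f) -> mu.-integrable setT (EFin \o g) ->
  (mu \x mu)%E.-integrable setT (fun z : R * R => (f z.1 * g z.2)%:E).
Proof.
move=> If Ig.
have mf : measurable_fun setT f by apply/measurable_EFinP; exact: measurable_int If.
have mg : measurable_fun setT g by apply/measurable_EFinP; exact: measurable_int Ig.
apply/integrable12ltyP.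
  apply/measurable_EFinP/measurable_funM.
    exact: measurableT_comp.
  exact: measurableT_comp.
have mgn : measurable_fun setT (fun y => `|g y|%:E).
  exact/measurable_EFinP/measurableT_comp.
have mfn : measurable_fun setT (fun y => `|f y|%:E).
  exact/measurable_EFinP/measurableT_comp.
move/integrableP: If => [_ If]; move/integrableP: Ig => [_ Ig].
rewrite (_ : (\int[mu]_x _ = (\int[mu]_x `|f x|%:E) * (\int[mu]_y `|g y|%:E)))%E.
  by apply: lte_mul_pinfty => //; rewrite ?ge0_fin_numE ?integral_ge0.
rewrite -ge0_integralZr ?integral_ge0//; apply: eq_integral => x _.
rewrite -ge0_integralZl//; apply: eq_integral => y _.
by rewrite /= normrM EFinM.
Qed.

Lemma integrable_addr (D : set R) (f g : R -> R) : measurable D ->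
  mu.-integrable D (EFin \o f) -> mu.-integrable D (EFin \o g) ->
  mu.-integrable D (EFin \o (fun x => f x + g x)).
Proof.
by move=> mD If Ig; exact: (integrableD _ If Ig).
Qed.

Lemma integrable_mulrl (D : set R) (c : R) (f : R -> R) : measurable D ->
  mu.-integrable D (EFin \o f) -> mu.-integrable D (EFin \o (fun x => c * f x)).
Proof.
by move=> mD If; exact: (integrableZl _ c If).
Qed.

Lemma integrable_mulrr (D : set R) (c : R) (f : R -> R) : measurable D ->
  mu.-integrable D (EFin \o f) -> mu.-integrable D (EFin \o (fun x => f x * c)).
Proof.
move=> mD If; rewrite (_ : _ \o _ = EFin \o (fun x => c * f x)).
  exact: integrable_mulrl.
by apply/funext => x; rewrite /= mulrC.
Qed.

Lemma integral_patchZ (c : R) (D : set R) (f : R -> R) : measurable D ->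
  mu.-integrable D (EFin \o f) ->
  (\int[mu]_x (c * (f \_ D) x)%:E)%E = (c * \int[mu]_(x in D) f x)%:E.
Proof.
move=> mD If.
have If' := integrable_patch mD If.
under eq_integral do rewrite EFinM.
rewrite integralZl// EFinM /Rintegral fineK; last exact: integrable_fin_num.
by congr (_ * _)%E; rewrite [RHS]integral_mkcond restrict_EFin.
Qed.

(** Both sides are the integral of [f s * g r] over the triangle
    [0 <= r <= s <= t], by Fubini. This replaces integration by parts for
    integrands that are merely integrable. *)
Lemma integral_triangle (f g : R -> R) (t : R) :
  mu.-integrable `[0, t] (EFin \o f) -> mu.-integrable `[0, t] (EFin \o g) ->
  \int[mu]_(s in `[0, t]) (f s * \int[mu]_(r in `[0, s]) g r) =
  \int[mu]_(r in `[0, t]) (g r * \int[mu]_(s in `[r, t]) f s).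
Proof.
move=> If Ig.
have p0 : (point : R) = 0 by [].
pose D := `[0, t]%classic.
have mD : measurable D by exact: measurable_itv.
have If' := integrable_patch mD If.
have Ig' := integrable_patch mD Ig.
pose T : set (R * R) := [set z | z.2 <= z.1].
have mT : measurable T.
  rewrite (_ : T = (fun z : R * R => z.1 - z.2) @^-1` `[0, +oo[%classic).
    by rewrite -[X in measurable X]setTI; apply: measurable_funB.
  by apply/seteqP; split => z /=; rewrite in_itv/= andbT subr_ge0.
pose h := (fun z : R * R => (f \_ D) z.1 * (g \_ D) z.2) \_ T.
have Ih : (mu \x mu)%E.-integrable setT (EFin \o h).
  rewrite /h -restrict_EFin; apply/integrable_restrict => //.
  apply: (@integrableS _ _ _ _ setT) => //; first by rewrite setTI.
  exact: integrable_tensor.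
rewrite [LHS]Rintegral_mkcond [RHS]Rintegral_mkcond /Rintegral.
congr fine; transitivity (\int[mu]_x fubini_F mu (EFin \o h) x)%E.
  apply: eq_integral => s _; rewrite /fubini_F/=.
  have -> : (fun r => (h (s, r))%:E) =
      (fun r => ((f \_ D) s * (g \_ (D `&` `]-oo, s]%classic)) r)%:E).
    apply/funext => r; congr EFin; rewrite /h patch_setI !patchE p0 /=.
    have -> : ((s, r) \in T) = (r \in (`]-oo, s]%classic)).
      by apply/idP/idP => /set_mem H; apply/mem_set; move: H; rewrite /T /= in_itv/=.
    by case: (r \in `]-oo, s]%classic); case: (r \in D); rewrite ?mulr0.
  rewrite integral_patchZ//; first last.
    apply: integrableS Ig => //; exact: measurableI.
    exact: measurableI.
  congr EFin; rewrite !patchE; rewrite ?p0; case: ifPn => [|_]; last by rewrite mul0r.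
  rewrite inE /D /= in_itv/= => /andP[s0 st]; congr (_ * _).
  congr (Rintegral mu _ _); apply/seteqP; split => r /=; rewrite !in_itv/=.
    by move=> /andP[-> rs]; rewrite rs (le_trans rs).
  by move=> [/andP[-> _]].
rewrite Fubini//; apply: eq_integral => r _; rewrite /fubini_G/=.
have -> : (fun s => (h (s, r))%:E) =
    (fun s => ((g \_ D) r * (f \_ (D `&` `[r, +oo[%classic)) s)%:E).
  apply/funext => s; congr EFin; rewrite /h patch_setI !patchE p0 /=.
  have -> : ((s, r) \in T) = (s \in (`[r, +oo[%classic)).
    by apply/idP/idP => /set_mem H; apply/mem_set; move: H; rewrite /T /= in_itv/= andbT.
  by case: (s \in `[r, +oo[%classic); case: (s \in D); rewrite ?mul0r ?mulr0// mulrC.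
rewrite integral_patchZ//; first last.
  apply: integrableS If => //; exact: measurableI.
  exact: measurableI.
congr EFin; rewrite !patchE; rewrite ?p0; case: ifPn => [|_]; last by rewrite mul0r.
rewrite inE /D /= in_itv/= => /andP[r0 rt]; congr (_ * _).
congr (Rintegral mu _ _); apply/seteqP; split => s /=; rewrite !in_itv/= ?andbT.
  by move=> [/andP[_ ->] ->].
by move=> /andP[rs ->]; rewrite rs (le_trans r0).
Qed.

(** This is the pathwise content of an identity [dX = a dt]. Unlike a statement
    about derivatives it determines the increments of [X]. *)
Definition primitive (T : R) (X a : R -> R) : Prop :=
  mu.-integrable `[0, T] (EFin \o a) /\
  forall t, 0 <= t <= T -> X t - X 0 = \int[mu]_(s in `[0, t]) a s.

Lemma itv0_sub (t T : R) : t <= T -> `[0, t]%classic `<=` `[0, T]%classic.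
Proof. by move=> tT; apply: subset_itvl; rewrite bnd_simp. Qed.

Lemma integrable_itv0 (t T : R) (f : R -> R) : t <= T ->
  mu.-integrable `[0, T] (EFin \o f) -> mu.-integrable `[0, t] (EFin \o f).
Proof. by move=> tT; apply: integrableS => //; exact: itv0_sub. Qed.

Lemma eq_primitive (T : R) (X a X' a' : R -> R) : 0 <= T ->
  {in `[0, T], X =1 X'} -> {in `[0, T], a =1 a'} ->
  primitive T X a -> primitive T X' a'.
Proof.
move=> T0 XX' aa' [Ia Xa].
have aa : {in `[0, T]%classic, a =1 a'} by move=> s /set_mem; exact: aa'.
split.
  by apply: eq_integrable Ia => // s sT; rewrite /= aa.
move=> t /andP[t0 tT]; rewrite -!XX' ?in_itv/= ?lexx ?t0//.
rewrite Xa ?t0//; apply: eq_Rintegral => s /set_mem st.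
by apply: aa; apply/mem_set/(itv0_sub tT).
Qed.

Lemma primitiveD (T : R) (X a Y b : R -> R) : primitive T X a -> primitive T Y b ->
  primitive T (fun t => X t + Y t) (fun t => a t + b t).
Proof.
move=> [Ia IX] [Ib IY]; split; first exact: integrable_addr.
move=> t /andP[t0 tT]; rewrite RintegralD//; first last.
- exact: integrable_itv0 Ib.
- exact: integrable_itv0 Ia.
by rewrite -IX ?t0// -IY ?t0//; ring.
Qed.

Lemma primitive_sum (T : R) (I : Type) (r : seq I) (X a : I -> R -> R) :
  0 <= T -> (forall i, primitive T (X i) (a i)) ->
  primitive T (fun t => \sum_(i <- r) X i t) (fun t => \sum_(i <- r) a i t).
Proof.
move=> T0 Xa; elim: r => [|i r IH].
  apply: (@eq_primitive T (cst 0) (cst 0)) => //;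
    try by move=> t _; rewrite big_nil.
  split; first exact: integrable0.
  by move=> t _; rewrite subrr /Rintegral integral0_eq.
by apply: eq_primitive (primitiveD (Xa i) IH) => // t _; rewrite big_cons.
Qed.

Lemma primitiveZ (T c : R) (X a : R -> R) : primitive T X a ->
  primitive T (fun t => c * X t) (fun t => c * a t).
Proof.
move=> [Ia Xa]; split; first exact: integrable_mulrl.
move=> t /andP[t0 tT]; rewrite RintegralZl//; last first.
  by exact: integrable_itv0 Ia.
by rewrite -Xa ?t0// mulrBr.
Qed.

(** Continuity makes [X] bounded, which is what keeps [b * X] integrable for an
    integrable [b]. *)
Lemma primitive_continuous (T : R) (X a : R -> R) : 0 <= T -> primitive T X a ->
  {within `[0, T], continuous X}.
Proof.
move=> T0 [Ia Xa].
have cI := parameterized_integral_continuous T0 Ia.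
have c0 : {within `[0, T], continuous (cst (X 0) : R -> R)}.
  by apply: continuous_subspaceT => t; exact: cvg_cst.
have := within_continuousD c0 cI.
apply: (@subspace_eq_continuous _ _ R) => t /set_mem tT.
have {}tT : 0 <= t <= T by move: tT; rewrite /= in_itv.
transitivity (X 0 + \int[mu]_(s in `[0, t]) a s); first by [].
by rewrite -(Xa t tT) addrC subrK.
Qed.

Lemma integrableM_primitive (T : R) (X a b : R -> R) : 0 <= T -> primitive T X a ->
  mu.-integrable `[0, T] (EFin \o b) ->
  mu.-integrable `[0, T] (EFin \o (fun t => b t * X t)).
Proof.
move=> T0 /(primitive_continuous T0) cX Ib.
have -> : EFin \o (fun t => b t * X t) = ((EFin \o b) \* (EFin \o X))%E.
  by apply/funext => t /=; rewrite EFinM.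
apply: integrableMl => //.
  exact: subspace_continuous_measurable_fun.
have := continuous_compact cX (@segment_compact _ 0 T) => /compact_bounded.
move=> [M [Mr hM]]; exists M; split => // N MN x xT /=.
by apply: hM => //; exists x.
Qed.

(** Product rule. Replacing [Y] by [Y 0] plus its integral in the integral of
    [a * Y] gives an iterated integral over a triangle; exchanging the order
    turns it into the integral of [b r * (X t - X r)]. *)
Lemma primitiveM (T : R) (X a Y b : R -> R) : 0 <= T ->
  primitive T X a -> primitive T Y b ->
  primitive T (fun t => X t * Y t) (fun t => a t * Y t + b t * X t).
Proof.
move=> T0 pX pY; have [[Ia Xa] [Ib Yb]] := (pX, pY).
have IaY := integrableM_primitive T0 pY Ia.
have IbX := integrableM_primitive T0 pX Ib.
split; first exact: integrable_addr.
move=> t /andP[t0 tT].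
have {}IaY := integrable_itv0 tT IaY.
have {}IbX := integrable_itv0 tT IbX.
have {}Ia := integrable_itv0 tT Ia.
have {}Ib := integrable_itv0 tT Ib.
rewrite RintegralD//.
have E1 : \int[mu]_(s in `[0, t]) (a s * \int[mu]_(r in `[0, s]) b r) =
    \int[mu]_(s in `[0, t]) (a s * Y s) - (X t - X 0) * Y 0.
  rewrite Xa ?t0// -RintegralZr// -RintegralB//; last exact: integrable_mulrr.
  apply: eq_Rintegral => s /set_mem /=; rewrite in_itv/= => /andP[s0 st].
  by rewrite -Yb ?s0 ?(le_trans st)// mulrBr.
have E2 : \int[mu]_(r in `[0, t]) (b r * \int[mu]_(s in `[r, t]) a s) =
    (Y t - Y 0) * X t - \int[mu]_(r in `[0, t]) (b r * X r).
  rewrite Yb ?t0// -RintegralZr// -RintegralB//; last exact: integrable_mulrr.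
  apply: eq_Rintegral => s /set_mem /=; rewrite in_itv/= => /andP[s0 st].
  rewrite -mulrBr; congr (_ * _).
  have <- := @Rintegral_itv_obnd_cbnd _ s (BRight t) a; last first.
    by apply: integrableS Ia => //; apply: subset_itvr; rewrite bnd_simp.
  rewrite -(@Rintegral_itvB _ _ (BLeft 0))// ?bnd_simp//.
  by rewrite -!Xa ?s0 ?t0 ?(le_trans st)//; ring.
move: E1; rewrite integral_triangle// E2.
move: (Rintegral mu _ (fun r => b r * X r)) (Rintegral mu _ (fun s => a s * Y s)).
by move=> A B E; lra.
Qed.

(** A function whose integrals over all `[0, t] vanish is zero at its Lebesgue
    points, where it is the derivative of its indefinite integral. *)
Lemma primitive_cst_ae0 (T : R) (X a : R -> R) :
  primitive T X a -> {in `[0, T], forall t, X t = X 0} ->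
  {ae mu, forall t, t \in `[0, T] -> a t = 0}.
Proof.
move=> [Ia Xa] X0.
pose f := a \_ `[0, T]%classic.
have If : mu.-integrable setT (EFin \o f) by exact: integrable_patch.
have lf : locally_integrable [set: R] f by apply: integrable_locally.
have If' y : mu.-integrable [set` Interval (BLeft 0) (BRight y)] (EFin \o f).
  exact: integrableS If.
have := FTC1 If' lf.
have aeF := ae_filter_ringOfSetsType mu.
(* The two end points are discarded to have a neighbourhood inside. *)
apply: filterS3 (ae_neq 0) (ae_neq T) => t tn0 tnT /= + tT.
have /andP[t0 tT'] : 0 <= t <= T by rewrite in_itv in tT.
have {}t0 : 0 < t by rewrite lt_neqAle eq_sym tn0.
have {}tT' : t < T by rewrite lt_neqAle tnT.
rewrite lte_fin => /(_ t0)[_]; rewrite /f patchE mem_set// => <-.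
rewrite -/f.
have nt : \forall x \near t, (\int[mu]_(s in `[0, x]) f s) = (cst 0 : R -> R) x.
  near=> x.
  have /andP[x0 xT] : 0 <= x <= T.
    by apply/andP; split; near: x; [exact: lt_le_nbhsr|exact: lt_le_nbhsl].
  transitivity (\int[mu]_(s in `[0, x]) a s).
    apply: eq_Rintegral => s /set_mem sx; rewrite /f patchE mem_set//.
    exact: itv0_sub sx.
  by rewrite -Xa ?x0// X0 ?subrr// in_itv/= x0.
rewrite derive1E (near_eq_derive _ nt)// -derive1E derive1_cst.
Unshelve. all: by end_near. Qed.

(** Serves the components in the kernel of [M], where [v] has no regularity in
    time besides measurability; that hypothesis is what makes the product
    integrable, since Borel measurability is not inherited from the vanishing
    of [a] outside a null set. *)
Lemma primitive_null (T : R) (v a : R -> R) :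
  measurable_fun `[0, T] v -> mu.-integrable `[0, T] (EFin \o a) ->
  {ae mu, forall t, t \in `[0, T] -> a t = 0} ->
  primitive T (cst 0) (fun t => v t * a t).
Proof.
move=> mv Ia a0.
have ma : measurable_fun `[0, T] a by apply/measurable_EFinP; exact: measurable_int Ia.
have mva : measurable_fun `[0, T] (EFin \o (fun t => v t * a t)).
  by apply/measurable_EFinP; exact: measurable_funM.
have va0 : ae_eq mu `[0, T]%classic (EFin \o (fun t => v t * a t)) (cst 0%E).
  have aeF := ae_filter_ringOfSetsType mu.
  by apply: filterS a0 => t /= at0 tT; rewrite at0 ?mulr0.
have Iva : mu.-integrable `[0, T] (EFin \o (fun t => v t * a t)).
  apply/integrableP; split=> //.
  rewrite (ae_eq_integral (cst 0%E)) ?integral0//.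
    exact: measurableT_comp.
  have aeF := ae_filter_ringOfSetsType mu.
  by apply: filterS va0 => t /= vat0 tT; move: (vat0 tT) => [->]; rewrite normr0.
split=> // t /andP[t0 tT]; rewrite subrr /Rintegral.
rewrite (ae_eq_integral (cst 0%E)) ?integral0//.
- exact: measurable_int (integrable_itv0 tT Iva).
- have aeF := ae_filter_ringOfSetsType mu.
  by apply: filterS va0 => s /= vas0 st; apply: vas0; exact: itv0_sub st.
Qed.
End TimeCalculus.

(** * Integrals of functions that are polynomial inside an interval *)

Section PolyIntegral.
Context {R : realType}.
Local Notation mu := (@lebesgue_measure R).

(** The end points are left out because finite element functions are
    unconstrained on the interfaces; they do not affect integrals. *)
Definition poly_on (a b : R) (F : R -> R) : Prop :=
  exists p : {poly R}, forall x, a < x < b -> F x = p.[x].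

Definition poly_int (a b : R) (p : {poly R}) : R := \int[mu]_(x in `[a, b]) p.[x].

Lemma integrable_horner (a b : R) (p : {poly R}) :
  mu.-integrable `[a, b] (EFin \o horner p).
Proof.
apply: continuous_compact_integrable; first exact: segment_compact.
by apply: continuous_subspaceT; exact: continuous_horner.
Qed.

Lemma poly_intD (a b : R) p q : poly_int a b (p + q) = poly_int a b p + poly_int a b q.
Proof.
rewrite /poly_int -RintegralD//; try exact: integrable_horner.
by apply: eq_Rintegral => x _; rewrite hornerD.
Qed.

Lemma poly_intZ (a b c : R) p : poly_int a b (c *: p) = c * poly_int a b p.
Proof.
rewrite /poly_int -RintegralZl//; try exact: integrable_horner.
by apply: eq_Rintegral => x _; rewrite hornerZ.
Qed.

Lemma poly_int0 (a b : R) : poly_int a b 0 = 0.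
Proof. by rewrite -(scale0r 0) poly_intZ mul0r. Qed.

Lemma poly_intB (a b : R) p q : poly_int a b (p - q) = poly_int a b p - poly_int a b q.
Proof. by rewrite poly_intD -scaleN1r poly_intZ mulN1r. Qed.

Lemma poly_int_sum (a b : R) (I : Type) (r : seq I) (p : I -> {poly R}) :
  poly_int a b (\sum_(i <- r) p i) = \sum_(i <- r) poly_int a b (p i).
Proof.
by elim: r => [|i r IH]; rewrite ?big_nil ?poly_int0// !big_cons poly_intD IH.
Qed.

Lemma poly_int_deriv (a b : R) (p : {poly R}) : a < b ->
  poly_int a b p^`() = p.[b] - p.[a].
Proof.
move=> ab; rewrite /poly_int /Rintegral (continuous_FTC2 (F := horner p))//.
- by apply: continuous_subspaceT; exact: continuous_horner.
- split=> [x _||]; first exact: derivable_horner.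
    by apply: cvg_at_right_filter; exact: continuous_horner.
  by apply: cvg_at_left_filter; exact: continuous_horner.
- by move=> x _; rewrite derivE.
Qed.

Lemma poly_on_integral (a b : R) (F : R -> R) (p : {poly R}) : a < b ->
  (forall x, a < x < b -> F x = p.[x]) ->
  mu.-integrable `[a, b] (EFin \o F) /\ \int[mu]_(x in `[a, b]) F x = poly_int a b p.
Proof.
move=> ab Fp; have Ip := integrable_horner a b p.
have Ioo : mu.-integrable `]a, b[ (EFin \o F).
  have : mu.-integrable `]a, b[ (EFin \o horner p).
    apply: integrableS Ip => //; exact: subset_itv_oo_cc.
  apply: eq_integrable => // x /set_mem/=; rewrite in_itv/= => xab.
  by rewrite Fp.
have mF : measurable_fun `[a, b] F.
  apply: (@measurable_fun_itv_cc _ _ _ false true).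
  by apply/measurable_EFinP; exact: measurable_int Ioo.
have ae : ae_eq mu `[a, b]%classic (EFin \o F) (EFin \o horner p).
  have aeF := ae_filter_ringOfSetsType mu.
  apply: filterS2 (ae_neq a) (ae_neq b) => x xa xb /=; rewrite in_itv/= => /andP[ax xb'].
  by rewrite Fp// !lt_neqAle eq_sym xa xb ax.
have mF' : measurable_fun `[a, b] (EFin \o F) by exact/measurable_EFinP.
have mp : measurable_fun `[a, b] (EFin \o horner p) by exact: measurable_int Ip.
split; last first.
  rewrite /poly_int /Rintegral; congr fine; exact: ae_eq_integral.
apply/integrableP; split => //.
have -> : (\int[mu]_(x in `[a, b]) `|(EFin \o F) x| =
    \int[mu]_(x in `[a, b]) `|(EFin \o horner p) x|)%E.
  apply: ae_eq_integral => //; [exact: measurableT_comp|exact: measurableT_comp|].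
  have aeF := ae_filter_ringOfSetsType mu.
  by apply: filterS ae => x /= Fx xab; move: (Fx xab) => [->].
by move/integrableP: Ip => [].
Qed.

End PolyIntegral.

(** * Orthonormal polynomials on an interval *)

Section Orthonormal.
Context {R : realType}.
Local Notation mu := (@lebesgue_measure R).

(** More zeros than the degree allows: the points [a + (b - a) / (i + 2)]. *)
Lemma poly_eq0_on (a b : R) (p : {poly R}) : a < b ->
  (forall x, a < x < b -> p.[x] = 0) -> p = 0.
Proof.
move=> ab p0; apply/eqP/negP => /negP pn0.
pose f (i : nat) : R := a + (b - a) / i.+2%:R.
have := @max_poly_roots _ p [seq f i | i <- iota 0 (size p)] pn0.
rewrite size_map size_iota ltnn => H; suff: false by []. apply: H.
- apply/allP => _ /mapP[i _ ->]; apply/rootP/p0; rewrite /f.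
  rewrite ltrDl divr_gt0 ?subr_gt0//= -ltrBrDl ltr_pdivrMr//.
  by rewrite ltr_pMr ?subr_gt0// ltr1n.
- rewrite map_inj_uniq ?iota_uniq// => i j /addrI /mulfI.
  by rewrite subr_eq0 gt_eqF// => /(_ isT)/invr_inj/eqP; rewrite eqr_nat => /eqP[].
Qed.

(** If the integral of the square were zero, so would be its integral over every
    `[a, y], and differentiating in [y] would give [p = 0] on the interval. *)
Lemma poly_int_sqr_gt0 (a b : R) (p : {poly R}) : a < b -> p != 0 ->
  0 < poly_int a b (p * p).
Proof.
move=> ab pn0; have sq0 x : 0 <= (p * p).[x] by rewrite hornerM -expr2 sqr_ge0.
rewrite lt_neqAle Rintegral_ge0 ?andbT//; apply: contra_neq pn0 => I0.
have Ip := integrable_horner a b (p * p).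
apply: (poly_eq0_on ab) => x /andP[ax xb].
have [_] := continuous_FTC1_closed xb Ip ax (@continuous_horner _ _ x).
have nt : \forall y \near x,
    (\int[mu]_(s in `[a, y]) (p * p).[s]) = (cst 0 : R -> R) y.
  near=> y.
  have ay : a < y by near: y; exact: lt_nbhsr.
  have yb : y < b by near: y; exact: lt_nbhsl.
  have := @Rintegral_itvB _ _ (BLeft a) (BRight b) y Ip.
  rewrite !bnd_simp => /(_ (ltW ay) (ltW yb)).
  rewrite -[X in X - _ = _]/(poly_int a b (p * p)) -I0 sub0r => E.
  apply/eqP; rewrite eq_le Rintegral_ge0 ?andbT// -oppr_ge0 E.
  exact: Rintegral_ge0.
rewrite derive1E (near_eq_derive _ nt) -derive1E derive1_cst hornerM => /esym/eqP.
by rewrite mulf_eq0 orbb => /eqP.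
Unshelve. all: by end_near. Qed.

(** Gram-Schmidt on the monomials: ['X^n] minus its projection has leading
    coefficient 1, hence is nonzero and can be normalized. *)
Lemma orthonormal_basis (a b : R) (n : nat) : a < b ->
  exists e : nat -> {poly R},
    [/\ forall i, (size (e i) <= i.+1)%N,
        forall i j, (i < n)%N -> (j < n)%N -> poly_int a b (e i * e j) = (i == j)%:R
      & forall p : {poly R}, (size p <= n)%N ->
        p = \sum_(i < n) poly_int a b (p * e i) *: e i].
Proof.
move=> ab; elim: n => [|n [e [se oe ee]]].
  exists (fun=> 0); split=> // [i|p]; first by rewrite size_poly0.
  by rewrite leqn0 size_poly_eq0 => /eqP ->; rewrite big_ord0.
(* The component of 'X^n orthogonal to the earlier ones. *)
pose r : {poly R} := 'X^n - \sum_(i < n) poly_int a b ('X^n * e i) *: e i.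
have rn : r`_n = 1.
  rewrite coefB coefXn eqxx coef_sum big1 ?subr0// => i _.
  by rewrite coefZ nth_default ?mulr0// (leq_trans (se i)).
have sr : (size r <= n.+1)%N.
  rewrite (leq_trans (size_polyD _ _))// geq_max size_polyXn leqnn size_polyN/=.
  apply: (leq_trans (size_sum _ _ _)); apply/bigmax_leqP => i _.
  by rewrite (leq_trans (size_scale_leq _ _))// (leq_trans (se i))// ltnS ltnW.
have r0 : r != 0 by apply: contra_eq_neq rn => ->; rewrite coef0 eq_sym oner_eq0.
pose N := poly_int a b (r * r); have N0 : 0 < N by exact: poly_int_sqr_gt0.
pose s := Num.sqrt N; have s0 : s != 0 by rewrite gt_eqF// sqrtr_gt0.
have ss : s * s = N by rewrite -expr2 sqr_sqrtr// ltW.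
have re i : (i < n)%N -> poly_int a b (r * e i) = 0.
  move=> ltin; rewrite mulrBl poly_intB mulr_suml poly_int_sum.
  rewrite (bigD1 (Ordinal ltin))//= big1 => [|j jn]; rewrite -scalerAl poly_intZ oe//.
    by rewrite eqxx mulr1 addr0 subrr.
  by rewrite (_ : (j == i :> nat) = false) ?mulr0//; apply/negbTE.
pose e' i := if i == n then s^-1 *: r else e i.
have e'n i : (i < n)%N -> e' i = e i by move=> ltin; rewrite /e' ltn_eqF.
have e'nn : e' n = s^-1 *: r by rewrite /e' eqxx.
exists e'; split.
- move=> i; rewrite /e'; case: eqP => [->|_]//.
  by rewrite (leq_trans (size_scale_leq _ _)).
- move=> i j; rewrite [(i < _)%N]ltnS [(i <= _)%N]leq_eqVlt => /predU1P[->|ltin];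
    rewrite [(j < _)%N]ltnS [(j <= _)%N]leq_eqVlt => /predU1P[->|ltjn].
  + by rewrite e'nn -scalerAl -scalerAr !poly_intZ -/N -ss eqxx mulKf ?mulVf.
  + by rewrite e'nn e'n// -scalerAl poly_intZ re// mulr0 gtn_eqF.
  + by rewrite e'nn e'n// mulrC -scalerAl poly_intZ re// mulr0 ltn_eqF.
  + by rewrite !e'n// oe.
- move=> p sp; pose q := p - p`_n *: r.
  have sq : (size q <= n)%N.
    apply/leq_sizeP => i; rewrite leq_eqVlt => /predU1P[<-|ltni].
      by rewrite coefB coefZ rn mulr1 subrr.
    rewrite coefB coefZ (nth_default 0 (leq_trans sp ltni)).
    by rewrite (nth_default 0 (leq_trans sr ltni)) mulr0 subr0.
  have qr : poly_int a b (q * r) = 0.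
    rewrite {1}(ee q sq) mulr_suml poly_int_sum big1// => i _.
    by rewrite -scalerAl poly_intZ [_ * r]mulrC re// mulr0.
  have pq : p = q + p`_n *: r by rewrite subrK.
  (* Split p along r: what remains has lower degree. *)
  have pz z : poly_int a b (p * z) = poly_int a b (q * z) + p`_n * poly_int a b (r * z).
    by rewrite -poly_intZ -poly_intD scalerAl -mulrDl -pq.
  rewrite big_ord_recr/= e'nn -scalerAr poly_intZ pz qr add0r -/N -ss scalerA.
  rewrite (_ : _ * _ * _ = p`_n); last by field.
  rewrite [LHS]pq; congr (_ + _); rewrite [LHS](ee q sq).
  by apply: eq_bigr => i _; rewrite e'n// pz re// mulr0 addr0.
Qed.

End Orthonormal.

(** * Flux algebra at an interface, and one-sided limits of vector polynomials *)

Section Dot.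
Context {R : realType}.
Implicit Types (u v w : 'cV[R]_9) (K A : 'M[R]_9).

Lemma dotvE u v : dotv u v = (u^T *m v) 0 0.
Proof. by rewrite !mxE; apply: eq_bigr => c _; rewrite mxE. Qed.

Lemma dotvC u v : dotv u v = dotv v u.
Proof. by apply: eq_bigr => c _; rewrite mulrC. Qed.

Lemma dotvDr u v w : dotv u (v + w) = dotv u v + dotv u w.
Proof. by rewrite !dotvE mulmxDr mxE. Qed.

Lemma dotvZr a u v : dotv u (a *: v) = a * dotv u v.
Proof. by rewrite !dotvE -scalemxAr mxE. Qed.

Lemma dotvNr u v : dotv u (- v) = - dotv u v.
Proof. by rewrite -scaleN1r dotvZr mulN1r. Qed.

Lemma dotvDl u v w : dotv (v + w) u = dotv v u + dotv w u.
Proof. by rewrite !(dotvC _ u) dotvDr. Qed.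

Lemma dotvZl a u v : dotv (a *: v) u = a * dotv v u.
Proof. by rewrite !(dotvC _ u) dotvZr. Qed.

Lemma dotvNl u v : dotv (- v) u = - dotv v u.
Proof. by rewrite !(dotvC _ u) dotvNr. Qed.

Lemma dotv_sumr (I : Type) (r : seq I) (P : pred I) (F : I -> 'cV[R]_9) u :
  dotv u (\sum_(i <- r | P i) F i) = \sum_(i <- r | P i) dotv u (F i).
Proof. by rewrite dotvE mulmx_sumr summxE; apply: eq_bigr => i _; rewrite dotvE. Qed.

Lemma dotv_adj K u v : dotv (K *m u) v = dotv u (K^T *m v).
Proof. by rewrite !dotvE trmx_mul mulmxA. Qed.

Lemma dotv_skew K u v : K^T = - K -> dotv (K *m u) v = - dotv (K *m v) u.
Proof. by move=> Ks; rewrite dotv_adj Ks mulNmx dotvNr dotvC. Qed.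

Lemma dotv_sym A u v : A^T = A -> dotv (A *m u) v = dotv (A *m v) u.
Proof. by move=> As; rewrite dotv_adj As dotvC. Qed.

Lemma dotv_delta u c a : dotv u (a *: delta_mx c 0) = a * u c 0.
Proof.
rewrite dotvZr /dotv (bigD1 c)//= big1 ?mxE ?eqxx ?mulr1 ?addr0// => d dc.
by rewrite !mxE (negbTE dc) mulr0.
Qed.

(** The numerical flux as a function of the right and left values, so that the
    interface identities below are plain vector algebra. *)
Definition pflux K A (zp zm : 'cV[R]_9) : 'cV[R]_9 :=
  K *m (2^-1 *: (zp + zm)) + A *m (zp - zm).

(** The left value of [K u . v] differs from its mean by half its jump, and
    that jump is [K {u} . [v] + K [u] . {v}]. The jump of the test function
    paired with the flux produces the same two terms, by skewness of [K]; the
    contributions of [A] cancel since it is symmetric. *)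
Lemma interface_minus K A up um vp vm : K^T = - K -> A^T = A ->
  dotv (K *m um) vm - dotv (pflux K A up um) vm + dotv (pflux K A vp vm) um =
  2^-1 * (dotv (K *m up) vp + dotv (K *m um) vm)
  - dotv (pflux K A up um) (2^-1 *: (vp + vm))
  + dotv (pflux K A vp vm) (2^-1 *: (up + um)).
Proof.
move=> Ks As; rewrite /pflux -!scalemxAr !mulmxBr !mulmxDr.
rewrite !(dotvDl, dotvZl, dotvDr, dotvZr, dotvNl).
rewrite !(dotv_skew vp _ Ks) !(dotv_skew vm _ Ks) !(dotv_sym vp _ As).
by rewrite !(dotv_sym vm _ As); lra.
Qed.

(** Same computation with the right values: the sign of the half jump changes
    everywhere. *)
Lemma interface_plus K A up um vp vm : K^T = - K -> A^T = A ->
  dotv (K *m up) vp - dotv (pflux K A up um) vp + dotv (pflux K A vp vm) up =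
  2^-1 * (dotv (K *m up) vp + dotv (K *m um) vm)
  - dotv (pflux K A up um) (2^-1 *: (vp + vm))
  + dotv (pflux K A vp vm) (2^-1 *: (up + um)).
Proof.
move=> Ks As; rewrite /pflux -!scalemxAr !mulmxBr !mulmxDr.
rewrite !(dotvDl, dotvZl, dotvDr, dotvZr, dotvNl).
rewrite !(dotv_skew vp _ Ks) !(dotv_skew vm _ Ks) !(dotv_sym vp _ As).
by rewrite !(dotv_sym vm _ As); lra.
Qed.

Definition vhorner (q : 'I_9 -> {poly R}) (x : R) : 'cV[R]_9 := \col_c (q c).[x].

Lemma cvg_cV (T : Type) (F : set_system T) (FF : Filter F) (f : T -> 'cV[R]_9)
    (l : 'cV[R]_9) :
  (forall c, f x c 0 @[x --> F] --> l c 0) -> f x @[x --> F] --> l.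
Proof.
move=> fl; apply/cvgrPdist_le => e e0; near=> x.
rewrite /Num.Def.normr/= mx_normrE (bigmax_le _ (ltW e0))//= => -[i j] _.
rewrite ord1 !mxE/= -[X in f x i X](ord1 0).
move: i; near: x; apply: filter_forall => /= i.
exact: ((cvgrPdist_le _ _).1 (fl i)).
Unshelve. all: by end_near. Qed.

Lemma vhorner_continuous q : continuous (vhorner q).
Proof.
move=> x; apply: cvg_cV => c; rewrite mxE.
rewrite (_ : (fun y => _) = horner (q c)); first exact: continuous_horner.
by apply/funext => y; rewrite mxE.
Qed.

Lemma cvg_vhorner_right (a b : R) (z : R -> 'cV[R]_9) q : a < b ->
  (forall x, a < x < b -> z x = vhorner q x) -> z x @[x --> a^'+] --> vhorner q a.
Proof.
move=> ab zq; apply: cvg_trans (cvg_at_right_filter (@vhorner_continuous q a)).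
apply: near_eq_cvg; near=> x; apply/esym/zq/andP; split; near: x.
  exact: nbhs_right_gt.
exact: nbhs_right_lt.
Unshelve. all: by end_near. Qed.

Lemma cvg_vhorner_left (a b : R) (z : R -> 'cV[R]_9) q : a < b ->
  (forall x, a < x < b -> z x = vhorner q x) -> z x @[x --> b^'-] --> vhorner q b.
Proof.
move=> ab zq; apply: cvg_trans (cvg_at_left_filter (@vhorner_continuous q b)).
apply: near_eq_cvg; near=> x; apply/esym/zq/andP; split; near: x.
  exact: nbhs_left_gt.
exact: nbhs_left_lt.
Unshelve. all: by end_near. Qed.

Lemma cvg_sumr (T I : Type) (F : set_system T) (FF : Filter F) (r : seq I)
    (f : I -> T -> R) (l : I -> R) :
  (forall c, f c x @[x --> F] --> l c) ->
  \sum_(c <- r) f c x @[x --> F] --> \sum_(c <- r) l c.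
Proof.
move=> fl; elim: r => [|c r IH].
  rewrite big_nil (_ : (fun x => _) = cst 0); first exact: cvg_cst.
  by apply/funext => x; rewrite big_nil.
rewrite big_cons (_ : (fun x => _) = f c \+ (fun x => \sum_(j <- r) f j x)).
  exact: cvgD.
by apply/funext => x; rewrite big_cons.
Qed.

Lemma cvg_dotv (T : Type) (F : set_system T) (FF : Filter F)
    (f g : T -> 'cV[R]_9) (l m : 'cV[R]_9) :
  f x @[x --> F] --> l -> g x @[x --> F] --> m ->
  dotv (f x) (g x) @[x --> F] --> dotv l m.
Proof.
move=> fl gm; rewrite /dotv; apply: cvg_sumr => c.
apply: cvgM.
  exact: (cvg_comp _ _ fl (@coord_continuous _ _ _ c 0 l)).
exact: (cvg_comp _ _ gm (@coord_continuous _ _ _ c 0 m)).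
Qed.

Lemma cvg_mulmx (T : Type) (F : set_system T) (FF : Filter F) K
    (f : T -> 'cV[R]_9) (l : 'cV[R]_9) :
  f x @[x --> F] --> l -> K *m f x @[x --> F] --> K *m l.
Proof.
move=> fl; apply: cvg_cV => c.
rewrite mxE (_ : (fun x => _) = fun x => \sum_d K c d * f x d 0); last first.
  by apply/funext => x; rewrite mxE.
apply: cvg_sumr => d.
apply: cvgM; first exact: cvg_cst.
exact: (cvg_comp _ _ fl (@coord_continuous _ _ _ d 0 l)).
Qed.

Lemma derive1_vhorner (a b : R) (z : R -> 'cV[R]_9) q :
  (forall x, a < x < b -> z x = vhorner q x) ->
  forall x, a < x < b -> derive1 z x = vhorner (fun c => (q c)^`()) x.
Proof.
move=> zq x /andP[ax xb].
rewrite derive1E (@near_eq_derive _ _ _ _ (vhorner q)); last first.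
  near=> y; apply: zq; apply/andP; split; near: y.
    exact: lt_nbhsr.
  exact: lt_nbhsl.
have E c : (fun y => vhorner q y c 0) = horner (q c).
  by apply/funext => y; rewrite mxE.
rewrite derive_mx; last first.
  apply/derivable_mxP => c d; rewrite ord1 E; exact: derivable_horner.
by apply/matrixP => c d; rewrite !mxE ord1 E -derive1E derivE.
Unshelve. all: by end_near. Qed.

End Dot.

(** * Discrete integration by parts along a line *)

Section Line.
Context {R : realType}.
Local Notation mu := (@lebesgue_measure R).
Implicit Types (g : grid R) (K A : 'M[R]_9) (z u v phi : R -> 'cV[R]_9).

Definition in_cell g (i : nat) (x : R) := node g i < x < node g i.+1.

Lemma cell_intE g i x : cell_int g i x = in_cell g i x.
Proof. by rewrite /cell_int /= in_itv. Qed.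

(** The integrand, for fixed transverse variable, of the terms of the scheme
    coming from one space derivative. *)
Definition line_terms g K A z phi i : R :=
  \int[mu]_(x in cell g i) dotv (K *m z x) (derive1 phi x)
  - dotv (flux g K A z i.+1) (trm g phi i.+1)
  + dotv (flux g K A z i) (trp g phi i).

Lemma cvg_trp g i (V : normedModType R) (z : R -> V) (l : V) : (i < ncells g)%N ->
  z x @[x --> (node g i)^'+] --> l -> trp g z i = l.
Proof.
by move=> iN zl; rewrite /trp ltn_eqF//; apply: cvg_lim => //; exact: norm_hausdorff.
Qed.

Lemma trp_vhorner g i z q : (i < ncells g)%N ->
  (forall x, in_cell g i x -> z x = vhorner q x) -> trp g z i = vhorner q (node g i).
Proof.
by move=> iN zq; apply: cvg_trp => //; apply: cvg_vhorner_right zq; exact: node_lt.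
Qed.

Lemma trm_vhorner g i z q : (i < ncells g)%N ->
  (forall x, in_cell g i x -> z x = vhorner q x) ->
  trm g z i.+1 = vhorner q (node g i.+1).
Proof.
move=> iN zq; rewrite /trm/=; apply: cvg_lim; first exact: norm_hausdorff.
by apply: cvg_vhorner_left zq; exact: node_lt.
Qed.

(** The polynomial [K r . q], see [bilpolyE]. *)
Definition bilpoly K (r q : 'I_9 -> {poly R}) : {poly R} :=
  \sum_c (\sum_d K c d *: r d) * q c.

Lemma bilpolyE K r q x : (bilpoly K r q).[x] = dotv (K *m vhorner r x) (vhorner q x).
Proof.
rewrite /bilpoly horner_sum; apply: eq_bigr => c _; rewrite hornerM !mxE; congr (_ * _).
by rewrite horner_sum; apply: eq_bigr => d _; rewrite hornerZ !mxE.
Qed.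

Lemma bilpoly_skew K r q : K^T = - K -> bilpoly K r q = - bilpoly K q r.
Proof.
move=> Ks; have Kcd c d : K c d = - K d c.
  by have := congr1 (fun M : 'M[R]_9 => M c d) Ks; rewrite !mxE => ->; rewrite opprK.
rewrite /bilpoly; under eq_bigr do rewrite mulr_suml.
rewrite exchange_big/= -sumrN; apply: eq_bigr => d _.
rewrite mulr_suml -sumrN; apply: eq_bigr => c _.
by rewrite Kcd -!scalerAl scaleNr mulrC.
Qed.

Lemma deriv_bilpoly K r q : (bilpoly K r q)^`() =
  bilpoly K (fun d => (r d)^`()) q + bilpoly K r (fun c => (q c)^`()).
Proof.
rewrite /bilpoly raddf_sum -big_split; apply: eq_bigr => c _ /=.
rewrite derivM raddf_sum; congr (_ * _ + _).
by apply: eq_bigr => d _; rewrite /= derivZ.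
Qed.

(** The derivative and both traces of the test function see only the interior
    of the cell, so they may be computed on its polynomial representative. The
    fluxes stay as they are: they involve the neighbouring cells. *)
Lemma line_termsE g K A z phi i r q : (i < ncells g)%N ->
  (forall x, in_cell g i x -> z x = vhorner r x) ->
  (forall x, in_cell g i x -> phi x = vhorner q x) ->
  line_terms g K A z phi i =
  poly_int (node g i) (node g i.+1) (bilpoly K r (fun c => (q c)^`()))
  - dotv (flux g K A z i.+1) (vhorner q (node g i.+1))
  + dotv (flux g K A z i) (vhorner q (node g i)).
Proof.
move=> iN zr pq; rewrite /line_terms (trp_vhorner iN pq) (trm_vhorner iN pq).
congr (_ - _ + _).
apply: (poly_on_integral _ _).2; first exact: node_lt.
by move=> x xi; rewrite bilpolyE zr// (derive1_vhorner pq).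
Qed.

Lemma line_terms_sum g K A z i (I : finType) (phi : R -> 'cV[R]_9)
    (psi : I -> R -> 'cV[R]_9) (a : I -> R) r (q : I -> 'I_9 -> {poly R}) :
  (i < ncells g)%N ->
  (forall x, in_cell g i x -> z x = vhorner r x) ->
  (forall n x, in_cell g i x -> psi n x = vhorner (q n) x) ->
  (forall x, in_cell g i x -> phi x = \sum_n a n *: psi n x) ->
  line_terms g K A z phi i = \sum_n a n * line_terms g K A z (psi n) i.
Proof.
move=> iN zr pq phiE.
pose qs c := \sum_n a n *: q n c.
have vqs x : vhorner qs x = \sum_n a n *: vhorner (q n) x.
  apply/matrixP => c d; rewrite !mxE summxE horner_sum.
  by apply: eq_bigr => n _; rewrite hornerZ !mxE.
have pqs x : in_cell g i x -> phi x = vhorner qs x.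
  move=> xi; rewrite phiE// vqs; apply: eq_bigr => n _; by rewrite pq.
rewrite (line_termsE K A iN zr pqs).
rewrite (eq_bigr _ (fun n _ => congr1 ( *%R (a n)) (line_termsE K A iN zr (pq n)))).
move: (flux g K A z i.+1) (flux g K A z i) => F1 F0.
have -> : bilpoly K r (fun c => (qs c)^`()) =
    \sum_n a n *: bilpoly K r (fun c => (q n c)^`()).
  rewrite /bilpoly; under [RHS]eq_bigr do rewrite scaler_sumr.
  rewrite exchange_big; apply: eq_bigr => c _ /=.
  rewrite raddf_sum mulr_sumr; apply: eq_bigr => n _.
  by rewrite /= derivZ scalerAr.
rewrite (vqs (node g i)) (vqs (node g i.+1)) dotv_sumr (dotv_sumr _ _ _ F0).
rewrite poly_int_sum -sumrB -big_split; apply: eq_bigr => n _ /=.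
by rewrite poly_intZ !dotvZr mulrDr mulrBr.
Qed.

Definition piecewise g z :=
  forall i, (i < ncells g)%N ->
    exists q, forall x, in_cell g i x -> z x = vhorner q x.

Lemma right_cell_lt g i : (i <= ncells g)%N ->
  ((if i == ncells g then 0 else i) < ncells g)%N.
Proof.
by move=> iN; case: eqP => [_|/eqP ik]; rewrite ?ncells_gt0// ltn_neqAle ik.
Qed.

(** With [right_cell_lt], the periodic convention for traces: each interface,
    boundary included, has a genuine cell on either side. *)
Lemma left_cell g i : (i <= ncells g)%N ->
  exists2 k, (if i == 0 then ncells g else i)%N = k.+1 & (k < ncells g)%N.
Proof.
have N0 := ncells_gt0 g; case: i => [|i] iN; last by exists i.
by exists (ncells g).-1; rewrite /= prednK.
Qed.

Lemma piecewise_trp g z i : piecewise g z -> (i <= ncells g)%N ->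
  z x @[x --> (node g (if i == ncells g then 0%N else i))^'+] --> trp g z i.
Proof.
move=> pz iN; rewrite /trp; set k := if _ then _ else _.
have kN : (k < ncells g)%N := right_cell_lt iN.
have [q zq] := pz k kN.
have C := cvg_vhorner_right (node_lt kN) zq.
by rewrite (cvg_lim _ C)//; exact: norm_hausdorff.
Qed.

Lemma piecewise_trm g z i : piecewise g z -> (i <= ncells g)%N ->
  z x @[x --> (node g (if i == 0%N then ncells g else i))^'-] --> trm g z i.
Proof.
move=> pz iN; rewrite /trm; set k := if _ then _ else _.
have [k' -> kN] : exists2 k', k = k'.+1 & (k' < ncells g)%N := left_cell iN.
have [q zq] := pz k' kN.
have C := cvg_vhorner_left (node_lt kN) zq.
by rewrite (cvg_lim _ C)//; exact: norm_hausdorff.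
Qed.

Lemma fluxE g K A z i : flux g K A z i = pflux K A (trp g z i) (trm g z i).
Proof. by []. Qed.

(** The average inside [FK] is taken of the product [K u . v]; since both
    one-sided limits exist it is expressed by the traces of [u] and [v]. *)
Lemma FK_traces g K A u v i : piecewise g u -> piecewise g v ->
  (i <= ncells g)%N ->
  FK g K A u v i =
  2^-1 * (dotv (K *m trp g u i) (trp g v i) + dotv (K *m trm g u i) (trm g v i))
  - dotv (pflux K A (trp g u i) (trm g u i)) (2^-1 *: (trp g v i + trm g v i))
  + dotv (pflux K A (trp g v i) (trm g v i)) (2^-1 *: (trp g u i + trm g u i)).
Proof.
move=> pu pv iN; rewrite /FK /flux /pflux /avg /jump; congr (_ * (_ + _) - _ + _).
  apply: cvg_lim; first exact: norm_hausdorff.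
  apply: cvg_dotv; last exact: piecewise_trp.
  by apply: cvg_mulmx; exact: piecewise_trp.
apply: cvg_lim; first exact: norm_hausdorff.
apply: cvg_dotv; last exact: piecewise_trm.
by apply: cvg_mulmx; exact: piecewise_trm.
Qed.

(** Discrete integration by parts: the volume terms sum to the integral of
    [(K u . v)'], that is to the one-sided boundary values of [K u . v], which
    the interface identities convert into [FK]. *)
Lemma line_terms_skew g K A u v i : K^T = - K -> A^T = A ->
  piecewise g u -> piecewise g v -> (i < ncells g)%N ->
  line_terms g K A u v i - line_terms g K A v u i = FK g K A u v i.+1 - FK g K A u v i.
Proof.
move=> Ks As pu pv iN; have [[r ur] [q vq]] := (pu i iN, pv i iN).
rewrite (etrans (FK_traces K A pu pv iN) (esym (interface_minus _ _ _ _ Ks As))).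
rewrite (etrans (FK_traces K A pu pv (ltnW iN))
  (esym (interface_plus _ _ _ _ Ks As))).
rewrite (line_termsE K A iN ur vq) (line_termsE K A iN vq ur).
rewrite (trp_vhorner iN ur) (trp_vhorner iN vq) (trm_vhorner iN ur) (trm_vhorner iN vq).
rewrite -!bilpolyE.
have -> : bilpoly K q (fun c => (r c)^`()) = - bilpoly K (fun c => (r c)^`()) q.
  exact: bilpoly_skew.
have := @poly_int_deriv _ _ _ (bilpoly K r q) (node_lt iN).
rewrite deriv_bilpoly poly_intD -[- bilpoly _ _ _]scaleN1r poly_intZ mulN1r.
rewrite (fluxE g K A u i) (fluxE g K A u i.+1) (fluxE g K A v i) (fluxE g K A v i.+1).
rewrite (trp_vhorner iN ur) (trp_vhorner iN vq).
rewrite (trm_vhorner iN ur) (trm_vhorner iN vq) !bilpolyE.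
move: (pflux _ _ _ _) (pflux _ _ _ _) (pflux _ _ _ _) (pflux _ _ _ _) => F1 F2 F3 F4.
move: (poly_int _ _ _) (poly_int _ _ _) (dotv _ _) (dotv _ _) => I1 I2 d1 d2 E.
by lra.
Qed.

End Line.

(** * Polynomial dependence on the transverse variable *)

Section PolyOn.
Context {R : realType}.
Local Notation mu := (@lebesgue_measure R).
Context (a b : R).
Implicit Types (F G : R -> R).

Lemma poly_on_add F G : poly_on a b F -> poly_on a b G ->
  poly_on a b (fun x => F x + G x).
Proof.
by move=> [p Fp] [q Gq]; exists (p + q) => x xab; rewrite hornerD Fp// Gq.
Qed.

Lemma poly_on_mul F G : poly_on a b F -> poly_on a b G ->
  poly_on a b (fun x => F x * G x).
Proof.
by move=> [p Fp] [q Gq]; exists (p * q) => x xab; rewrite hornerM Fp// Gq.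
Qed.

Lemma poly_on_cst (c : R) : poly_on a b (fun=> c).
Proof. by exists c%:P => x _; rewrite hornerC. Qed.

Lemma poly_on_sum (I : Type) (r : seq I) (F : I -> R -> R) :
  (forall n, poly_on a b (F n)) -> poly_on a b (fun x => \sum_(n <- r) F n x).
Proof.
move=> pF; elim: r => [|n r [q IH]].
  by exists 0 => x _; rewrite big_nil horner0.
have [p Fp] := pF n; exists (p + q) => x xab.
by rewrite big_cons hornerD IH// Fp.
Qed.

Lemma integral_poly_on_sum (I : finType) (F : R -> R) (G : I -> R -> R)
    (c : I -> R) : a < b ->
  (forall n, poly_on a b (G n)) ->
  (forall x, a < x < b -> F x = \sum_n c n * G n x) ->
  \int[mu]_(x in `[a, b]) F x = \sum_n c n * \int[mu]_(x in `[a, b]) G n x.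
Proof.
move=> ab /fin_all_exists[p Gp] FE.
rewrite (poly_on_integral (p := \sum_n c n *: p n) ab _).2; last first.
  move=> x xab; rewrite FE// horner_sum; apply: eq_bigr => n _.
  by rewrite hornerZ Gp.
rewrite poly_int_sum; apply: eq_bigr => n _.
by rewrite poly_intZ (poly_on_integral ab (Gp n)).2.
Qed.

Lemma integral_poly_on_sub (F G H : R -> R) : a < b ->
  poly_on a b F -> poly_on a b G ->
  (forall x, a < x < b -> H x = F x - G x) ->
  \int[mu]_(x in `[a, b]) H x =
  \int[mu]_(x in `[a, b]) F x - \int[mu]_(x in `[a, b]) G x.
Proof.
move=> ab [p Fp] [q Gq] HE.
rewrite (poly_on_integral ab Fp).2 (poly_on_integral ab Gq).2 -poly_intB.
by apply: (poly_on_integral ab _).2 => x xab; rewrite HE// hornerD hornerN Fp// Gq.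
Qed.

Definition vpoly_on (W : R -> 'cV[R]_9) := forall c, poly_on a b (fun x => W x c 0).

Lemma poly_on_dotv W W' : vpoly_on W -> vpoly_on W' ->
  poly_on a b (fun x => dotv (W x) (W' x)).
Proof. by move=> pW pW'; apply: poly_on_sum => c; exact: poly_on_mul. Qed.

Lemma eq_poly_on F G : (forall x, F x = G x) -> poly_on a b F -> poly_on a b G.
Proof. by move=> FG [p Fp]; exists p => x xab; rewrite -FG Fp. Qed.

Lemma vpoly_on_pflux K A W W' : vpoly_on W -> vpoly_on W' ->
  vpoly_on (fun x => pflux K A (W x) (W' x)).
Proof.
move=> pW pW' c.
apply: (@eq_poly_on (fun x => \sum_d K c d * (2^-1 *: (W x + W' x)) d 0 +
    \sum_d A c d * (W x - W' x) d 0)).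
  by move=> x; rewrite /pflux !mxE.
apply: poly_on_add; apply: poly_on_sum => d; apply: poly_on_mul;
  try exact: poly_on_cst.
  apply: (@eq_poly_on (fun x => 2^-1 * (W x d 0 + W' x d 0))).
    by move=> x; rewrite !mxE.
  by apply: poly_on_mul; [exact: poly_on_cst|exact: poly_on_add].
apply: (@eq_poly_on (fun x => W x d 0 + (-1) * W' x d 0)).
  by move=> x; rewrite !mxE mulN1r.
by apply: poly_on_add => //; apply: poly_on_mul => //; exact: poly_on_cst.
Qed.

End PolyOn.

(** * The spatial terms on a rectangular cell *)

Section Plane.
Context {R : realType}.
Local Notation mu := (@lebesgue_measure R).
Implicit Types (g h : grid R) (K A : 'M[R]_9) (s : seq ({poly R} * {poly R})).

(** A finite sum of products of a polynomial in [x] and one in [y], as in the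
    definition of the finite element space but with an arbitrary degree: this
    class is also closed under products and derivatives. *)
Definition tensor_sum s (x y : R) : R := \sum_(pq <- s) pq.1.[x] * pq.2.[y].

(** The polynomial in [x] obtained by freezing [y]. *)
Definition slice s (y : R) : {poly R} := \sum_(pq <- s) pq.2.[y] *: pq.1.

Lemma sliceE s x y : (slice s y).[x] = tensor_sum s x y.
Proof.
by rewrite horner_sum; apply: eq_bigr => pq _; rewrite hornerZ mulrC.
Qed.

Definition cell_poly g h i j (f : R -> R -> R) : Prop :=
  exists s, forall x y, in_cell g i x -> in_cell h j y -> f x y = tensor_sum s x y.

Definition cell_vpoly g h i j (Z : R -> R -> 'cV[R]_9) : Prop :=
  forall c, cell_poly g h i j (fun x y => Z x y c 0).

Lemma cell_poly_swap g h i j f : cell_poly g h i j f ->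
  cell_poly h g j i (fun y x => f x y).
Proof.
move=> [s fs]; exists [seq (pq.2, pq.1) | pq <- s] => y x yj xi.
by rewrite fs// /tensor_sum big_map; apply: eq_bigr => pq _; rewrite mulrC.
Qed.

Lemma cell_poly_add g h i j f f' : cell_poly g h i j f -> cell_poly g h i j f' ->
  cell_poly g h i j (fun x y => f x y + f' x y).
Proof.
move=> [s fs] [s' fs']; exists (s ++ s') => x y xi yj.
by rewrite fs// fs'// /tensor_sum big_cat.
Qed.

Lemma cell_poly_mul g h i j f f' : cell_poly g h i j f -> cell_poly g h i j f' ->
  cell_poly g h i j (fun x y => f x y * f' x y).
Proof.
move=> [s fs] [s' fs'].
exists [seq (t.1 * t'.1, t.2 * t'.2) | t <- s, t' <- s'] => x y xi yj.
rewrite fs// fs'// /tensor_sum big_allpairs_dep mulr_suml; apply: eq_bigr => t _.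
rewrite mulr_sumr; apply: eq_bigr => t' _.
by rewrite !hornerM mulrACA.
Qed.

Lemma cell_poly_tensor g h i j (p q : {poly R}) :
  cell_poly g h i j (fun x y => p.[x] * q.[y]).
Proof. by exists [:: (p, q)] => x y _ _; rewrite /tensor_sum big_seq1. Qed.

Lemma cell_poly_cst g h i j (c : R) : cell_poly g h i j (fun _ _ => c).
Proof.
exists [:: (c%:P, 1)] => x y _ _.
by rewrite /tensor_sum big_seq1 !hornerC mulr1.
Qed.

Lemma cell_poly_sum g h i j (I : Type) (r : seq I) (f : I -> R -> R -> R) :
  (forall n, cell_poly g h i j (f n)) ->
  cell_poly g h i j (fun x y => \sum_(n <- r) f n x y).
Proof.
move=> bf; elim: r => [|n r IH].
  by exists [::] => x y _ _; rewrite /tensor_sum !big_nil.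
have [s ss] := cell_poly_add (bf n) IH; exists s => x y xi yj.
by rewrite big_cons; exact: ss.
Qed.

Lemma cell_vpoly_mulmx g h i j K Z : cell_vpoly g h i j Z ->
  cell_vpoly g h i j (fun x y => K *m Z x y).
Proof.
move=> bZ c; have [s ss] : cell_poly g h i j (fun x y => \sum_d K c d * Z x y d 0).
  by apply: cell_poly_sum => d; apply: cell_poly_mul => //; exact: cell_poly_cst.
by exists s => x y xi yj; rewrite mxE; exact: ss.
Qed.

Lemma cell_poly_dotv g h i j Z W : cell_vpoly g h i j Z -> cell_vpoly g h i j W ->
  cell_poly g h i j (fun x y => dotv (Z x y) (W x y)).
Proof. by move=> bZ bW; apply: cell_poly_sum => c; exact: cell_poly_mul. Qed.

Lemma cell_vpoly_slice g h i j Z : cell_vpoly g h i j Z ->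
  exists s : 'I_9 -> seq ({poly R} * {poly R}), forall y, in_cell h j y ->
    forall x, in_cell g i x -> Z x y = vhorner (fun c => slice (s c) y) x.
Proof.
move=> /fin_all_exists[s Zs]; exists s => y yj x xi.
by apply/matrixP => c d; rewrite ord1 !mxE sliceE Zs.
Qed.

(** Integrating in one variable leaves a polynomial in the other, which is what
    allows the outer integral to be treated as linear. *)
Lemma cell_poly_integral g h i j f : (i < ncells g)%N -> cell_poly g h i j f ->
  poly_on (node h j) (node h j.+1) (fun y => \int[mu]_(x in cell g i) f x y).
Proof.
move=> iN [s fs].
exists (\sum_(pq <- s) poly_int (node g i) (node g i.+1) pq.1 *: pq.2) => y yj.
rewrite (poly_on_integral (p := slice s y) (node_lt iN) _).2; last first.
  by move=> x xi; rewrite fs// sliceE.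
rewrite poly_int_sum horner_sum; apply: eq_bigr => pq _.
by rewrite poly_intZ hornerZ mulrC.
Qed.

Lemma cell_integral_tensor g h i j f s : (i < ncells g)%N -> (j < ncells h)%N ->
  (forall x y, in_cell g i x -> in_cell h j y -> f x y = tensor_sum s x y) ->
  cell_integral g h f i j =
  \sum_(pq <- s) poly_int (node g i) (node g i.+1) pq.1 *
                 poly_int (node h j) (node h j.+1) pq.2.
Proof.
move=> iN jN fs; rewrite /cell_integral.
pose P := \sum_(pq <- s) poly_int (node g i) (node g i.+1) pq.1 *: pq.2.
rewrite (poly_on_integral (p := P) (node_lt jN) _).2.
  by rewrite poly_int_sum; apply: eq_bigr => pq _; rewrite poly_intZ.
move=> y yj; rewrite (poly_on_integral (p := slice s y) (node_lt iN) _).2.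
  rewrite poly_int_sum horner_sum; apply: eq_bigr => pq _.
  by rewrite poly_intZ hornerZ mulrC.
by move=> x xi; rewrite fs// sliceE.
Qed.

Lemma cell_integral_sum g h i j (I : finType) f (F : I -> R -> R -> R)
    (c : I -> R) : (i < ncells g)%N -> (j < ncells h)%N ->
  (forall n, cell_poly g h i j (F n)) ->
  (forall x y, in_cell g i x -> in_cell h j y -> f x y = \sum_n c n * F n x y) ->
  cell_integral g h f i j = \sum_n c n * cell_integral g h (F n) i j.
Proof.
move=> iN jN bF fE; apply: integral_poly_on_sum; first exact: node_lt.
  by move=> n; exact: cell_poly_integral.
move=> y yj; apply: integral_poly_on_sum; first exact: node_lt.
  move=> n; have [s Fs] := bF n; exists (slice s y) => x xi.
  by rewrite sliceE Fs.
by move=> x xi; exact: fE.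
Qed.

Definition grid_poly g h (Z : R -> R -> 'cV[R]_9) : Prop :=
  forall i j, (i < ncells g)%N -> (j < ncells h)%N -> cell_vpoly g h i j Z.

Lemma grid_poly_piecewise g h Z j y : grid_poly g h Z -> (j < ncells h)%N ->
  in_cell h j y -> piecewise g (Z^~ y).
Proof.
move=> gZ jN yj i iN; have [s Zs] := cell_vpoly_slice (gZ i j iN jN).
by exists (fun c => slice (s c) y) => x xi; rewrite (Zs y).
Qed.

Lemma tensor_sum_poly_on a b s x : poly_on a b (tensor_sum s x).
Proof.
by apply: poly_on_sum => pq; apply: poly_on_mul; [exact: poly_on_cst|exists pq.2].
Qed.

(** As [y] runs through one cell, the trace at an interface of constant [x] is
    taken in a single adjacent cell, hence is polynomial in [y]. *)
Lemma trp_poly_on g h Z i j : grid_poly g h Z -> (i <= ncells g)%N ->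
  (j < ncells h)%N ->
  vpoly_on (node h j) (node h j.+1) (fun y => trp g (Z^~ y) i).
Proof.
move=> gZ iN jN c; rewrite /trp; set k := if _ then _ else _.
have kN : (k < ncells g)%N := right_cell_lt iN.
have [s Zs] := cell_vpoly_slice (gZ k j kN jN).
have [p sp] := tensor_sum_poly_on (node h j) (node h j.+1) (s c) (node g k).
exists p => y yj; rewrite -sp//.
have C := cvg_vhorner_right (node_lt kN) (Zs y yj).
by rewrite (cvg_lim _ C) ?mxE ?sliceE//; exact: norm_hausdorff.
Qed.

Lemma trm_poly_on g h Z i j : grid_poly g h Z -> (i <= ncells g)%N ->
  (j < ncells h)%N ->
  vpoly_on (node h j) (node h j.+1) (fun y => trm g (Z^~ y) i).
Proof.
move=> gZ iN jN c; rewrite /trm; set k := if _ then _ else _.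
have [k' -> kN] : exists2 k', k = k'.+1 & (k' < ncells g)%N := left_cell iN.
have [s Zs] := cell_vpoly_slice (gZ k' j kN jN).
have [p sp] := tensor_sum_poly_on (node h j) (node h j.+1) (s c) (node g k'.+1).
exists p => y yj; rewrite -sp//.
have C := cvg_vhorner_left (node_lt kN) (Zs y yj).
by rewrite (cvg_lim _ C) ?mxE ?sliceE//; exact: norm_hausdorff.
Qed.

Lemma line_terms_poly_on g h K A Z phi i j : grid_poly g h Z -> (i < ncells g)%N ->
  (j < ncells h)%N -> cell_vpoly g h i j phi ->
  poly_on (node h j) (node h j.+1) (fun y => line_terms g K A (Z^~ y) (phi^~ y) i).
Proof.
move=> gZ iN jN bphi; have [s phis] := cell_vpoly_slice bphi.
have neg F a b : poly_on a b F -> poly_on a b (fun y : R => - F y).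
  by move=> [p Fp]; exists (- p) => x xab; rewrite hornerN Fp.
have fluxp k : (k <= ncells g)%N ->
    vpoly_on (node h j) (node h j.+1) (fun y => flux g K A (Z^~ y) k).
  by move=> kN; apply: vpoly_on_pflux; [exact: trp_poly_on|exact: trm_poly_on].
rewrite /line_terms; apply: poly_on_add; first apply: poly_on_add.
- apply: cell_poly_integral => //; apply: cell_poly_dotv.
    exact: cell_vpoly_mulmx (gZ _ _ iN jN).
  move=> c; exists [seq (pq.1^`(), pq.2) | pq <- s c] => x y xi yj.
  rewrite (derive1_vhorner (phis y yj) xi) mxE /slice raddf_sum horner_sum.
  rewrite /tensor_sum big_map; apply: eq_bigr => pq _ /=.
  by rewrite derivZ hornerZ mulrC.
- apply: neg; apply: poly_on_dotv; first exact: fluxp.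
  move=> c; have [p sp] := tensor_sum_poly_on (node h j) (node h j.+1) (s c) (node g i.+1).
  by exists p => y yj; rewrite (trm_vhorner iN (phis y yj)) mxE sliceE sp.
- apply: poly_on_dotv; first by apply: fluxp; exact: ltnW.
  move=> c; have [p sp] := tensor_sum_poly_on (node h j) (node h j.+1) (s c) (node g i).
  by exists p => y yj; rewrite (trp_vhorner iN (phis y yj)) mxE sliceE sp.
Qed.

(** Both the x-terms and the y-terms of the scheme are of this form, the latter
    with the roles of the grids and of the arguments exchanged. *)
Definition dir_terms g h K A (Z phi : R -> R -> 'cV[R]_9) i j : R :=
  \int[mu]_(y in cell h j) line_terms g K A (Z^~ y) (phi^~ y) i.

Lemma dir_terms_sum g h K A Z phi i j (I : finType)
    (psi : I -> R -> R -> 'cV[R]_9) (a : I -> R) :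
  grid_poly g h Z -> (i < ncells g)%N -> (j < ncells h)%N ->
  (forall n, cell_vpoly g h i j (psi n)) ->
  (forall x y, in_cell g i x -> in_cell h j y ->
    phi x y = \sum_n a n *: psi n x y) ->
  dir_terms g h K A Z phi i j = \sum_n a n * dir_terms g h K A Z (psi n) i j.
Proof.
move=> gZ iN jN bpsi phiE; apply: integral_poly_on_sum; first exact: node_lt.
  by move=> n; exact: line_terms_poly_on.
move=> y yj; have [s Zs] := cell_vpoly_slice (gZ i j iN jN).
have /fin_all_exists[t psit] : forall n, exists s : 'I_9 -> seq ({poly R} * {poly R}),
    forall y, in_cell h j y -> forall x, in_cell g i x ->
    psi n x y = vhorner (fun c => slice (s c) y) x.
  by move=> n; exact: cell_vpoly_slice.
apply: (line_terms_sum (q := fun n c => slice (t n c) y) K A iN (Zs y yj)).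
  by move=> n x xi; rewrite (psit n y).
by move=> x xi; exact: phiE.
Qed.

(** [line_terms_skew] integrated in the transverse variable. Splitting the
    integral of the difference is legitimate as both parts are polynomial. *)
Lemma dir_terms_skew g h K A U V i j : K^T = - K -> A^T = A ->
  grid_poly g h U -> grid_poly g h V -> (i < ncells g)%N -> (j < ncells h)%N ->
  \int[mu]_(y in cell h j)
    (FK g K A (U^~ y) (V^~ y) i.+1 - FK g K A (U^~ y) (V^~ y) i) =
  dir_terms g h K A U V i j - dir_terms g h K A V U i j.
Proof.
move=> Ks As gU gV iN jN; apply: integral_poly_on_sub; first exact: node_lt.
- exact: line_terms_poly_on (gV _ _ iN jN).
- exact: line_terms_poly_on (gU _ _ iN jN).
- by move=> y yj; rewrite line_terms_skew//; apply: grid_poly_piecewise yj.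
Qed.

(** A test function with the single component [c] does not see the derivative
    and flux terms if row [c] of [K] and of [A] is zero. *)
Lemma dir_terms_null g h K A Z (ph : R -> R -> R) c i j :
  (i < ncells g)%N -> (j < ncells h)%N -> grid_poly g h Z ->
  cell_poly g h i j ph ->
  (forall z : 'cV[R]_9, (K *m z) c 0 = 0) ->
  (forall z : 'cV[R]_9, (A *m z) c 0 = 0) ->
  dir_terms g h K A Z (fun x y => ph x y *: delta_mx c 0) i j = 0.
Proof.
move=> iN jN gZ bph K0 A0; have [s phs] := bph.
rewrite /dir_terms (poly_on_integral (p := 0) (node_lt jN) _).2 ?poly_int0// => y yj.
have [t Zt] := cell_vpoly_slice (gZ i j iN jN).
pose q d := if d == c then slice s y else 0.
have phq x : in_cell g i x -> ph x y *: delta_mx c 0 = vhorner q x.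
  move=> xi; apply/matrixP => d l; rewrite ord1 !mxE /q eqxx andbT.
  by case: eqP => _; rewrite ?horner0 ?mulr0// mulr1 sliceE phs.
have vq x : vhorner q x = (slice s y).[x] *: delta_mx c 0.
  apply/matrixP => d l; rewrite ord1 !mxE /q eqxx andbT.
  by case: eqP => _; rewrite ?horner0 ?mulr0// mulr1.
have fl l : flux g K A (Z^~ y) l c 0 = 0 by rewrite fluxE mxE K0 A0 addr0.
rewrite (line_termsE K A iN (Zt y yj) phq) (vq (node g i)) (vq (node g i.+1)).
move: (fl i) (fl i.+1).
move: (flux g K A (Z^~ y) i.+1) (flux g K A (Z^~ y) i) => F1 F0 f0 f1.
rewrite !dotv_delta f0 f1 !mulr0 subr0 addr0.
rewrite horner0 (_ : bilpoly _ _ _ = 0) ?poly_int0//.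
rewrite /bilpoly big1// => d _; rewrite /q; case: eqP => [->|_]; last first.
  by rewrite deriv0 mulr0.
rewrite big1 ?mul0r// => d' _.
have := K0 (delta_mx d' 0); rewrite mxE (bigD1 d')//= big1 => [|l ld].
  by rewrite mxE !eqxx mulr1 addr0 => ->; rewrite scale0r.
by rewrite mxE (negbTE ld) mulr0.
Qed.

End Plane.

(** * The matrices of the Maxwell system *)

Section Matrices.
Context {R : realType}.
Local Notation mu := (@lebesgue_measure R).
Implicit Types (z : 'cV[R]_9).

Definition ord9 (n : nat) : 'I_9 := inord n.

Lemma eq_o m n : (m < 9)%N -> (n < 9)%N -> (ord9 m == ord9 n) = (m == n).
Proof. by move=> m9 n9; rewrite -val_eqE/= !inordK. Qed.

Lemma sum9 (V : nmodType) (F : 'I_9 -> V) :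
  \sum_c F c = F (ord9 0) + F (ord9 1) + F (ord9 2) + F (ord9 3) + F (ord9 4) + F (ord9 5)
             + F (ord9 6) + F (ord9 7) + F (ord9 8).
Proof.
rewrite (eq_bigr (fun c : 'I_9 => F (ord9 c))) => [|c _]; last by rewrite /ord9 inord_val.
by rewrite !big_ord_recr big_ord0/= add0r.
Qed.

Lemma unit_mxE a b z c :
  (unit_mx a b *m z) c 0 = (c == ord9 a.-1)%:R * z (ord9 b.-1) 0.
Proof.
rewrite mxE (bigD1 (ord9 b.-1))//= big1 ?addr0 => [|d dn].
  by rewrite /unit_mx mxE eqxx andbT.
by rewrite /unit_mx mxE (negbTE dn) andbF mul0r.
Qed.

Lemma tr_unit_mx a b : (unit_mx a b : 'M[R]_9)^T = unit_mx b a.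
Proof. exact: trmx_delta. Qed.

Lemma K1_skew : (K1 : 'M[R]_9)^T = - K1.
Proof.
rewrite /K1 [LHS]linearZ/= -scalerN; congr (_ *: _).
rewrite [LHS]linearD/= 2![in LHS]linearD/= ![in LHS]linearN/= !tr_unit_mx.
by rewrite !opprD !opprK; apply/matrixP => a b; rewrite !mxE; ring.
Qed.

Lemma K2_skew : (K2 : 'M[R]_9)^T = - K2.
Proof.
rewrite /K2 [LHS]linearZ/= -scalerN; congr (_ *: _).
rewrite [LHS]linearD/= 2![in LHS]linearD/= ![in LHS]linearN/= !tr_unit_mx.
by rewrite !opprD !opprK; apply/matrixP => a b; rewrite !mxE; ring.
Qed.

Lemma tr_unit_pair a b :
  (unit_mx a b + unit_mx b a : 'M[R]_9)^T = unit_mx a b + unit_mx b a.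
Proof. by rewrite [LHS]linearD/= !tr_unit_mx addrC. Qed.

Lemma A1_sym (m n : R) : (A1 m n)^T = A1 m n.
Proof.
by rewrite [LHS]linearD/=; congr (_ + _); rewrite [LHS]linearZ/= tr_unit_pair.
Qed.

Lemma A2_sym (m n : R) : (A2 m n)^T = A2 m n.
Proof.
by rewrite [LHS]linearD/=; congr (_ + _); rewrite [LHS]linearZ/= tr_unit_pair.
Qed.

Lemma addmxE (A B : 'M[R]_9) z c : ((A + B) *m z) c 0 = (A *m z) c 0 + (B *m z) c 0.
Proof. by rewrite mulmxDl mxE. Qed.

Lemma oppmxE (A : 'M[R]_9) z c : ((- A) *m z) c 0 = - (A *m z) c 0.
Proof. by rewrite mulNmx mxE. Qed.

Lemma scalemxE a (A : 'M[R]_9) z c : ((a *: A) *m z) c 0 = a * (A *m z) c 0.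
Proof. by rewrite -scalemxAl mxE. Qed.

Definition mxrowE := (addmxE, oppmxE, scalemxE, unit_mxE).

(** This and the next two lemmas describe [M]: it kills the first three
    components and exchanges the other two triples, with opposite signs. *)
Lemma Mmx_low z i : (i < 3)%N -> (Mmx *m z) (ord9 i) 0 = 0.
Proof.
move=> i3; rewrite /Mmx !mxrowE/= !eq_o//; try by rewrite (ltn_trans i3).
by case: i i3 => [|[|[|]]]//= _; ring.
Qed.

Lemma Mmx_mid z i : (i < 3)%N -> (Mmx *m z) (ord9 (3 + i)) 0 = - z (ord9 (6 + i)) 0.
Proof.
by case: i => [|[|[|]]]//= _; rewrite /Mmx !mxrowE/= !eq_o//=; ring.
Qed.

Lemma Mmx_high z i : (i < 3)%N -> (Mmx *m z) (ord9 (6 + i)) 0 = z (ord9 (3 + i)) 0.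
Proof.
by case: i => [|[|[|]]]//= _; rewrite /Mmx !mxrowE/= !eq_o//=; ring.
Qed.

(** Rows 7, 8, 9 of [K1], [K2], [A1], [A2] vanish: these equations of the
    scheme are free of space derivatives and of fluxes. *)
Lemma K1_high z i : (i < 3)%N -> (K1 *m z) (ord9 (6 + i)) 0 = 0.
Proof.
by case: i => [|[|[|]]]//= _; rewrite /K1 !mxrowE/= !eq_o//=; ring.
Qed.

Lemma K2_high z i : (i < 3)%N -> (K2 *m z) (ord9 (6 + i)) 0 = 0.
Proof.
by case: i => [|[|[|]]]//= _; rewrite /K2 !mxrowE/= !eq_o//=; ring.
Qed.

Lemma A1_high m n z i : (i < 3)%N -> (A1 m n *m z) (ord9 (6 + i)) 0 = 0.
Proof.
by case: i => [|[|[|]]]//= _; rewrite /A1 !mxrowE/= !eq_o//=; ring.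
Qed.

Lemma A2_high m n z i : (i < 3)%N -> (A2 m n *m z) (ord9 (6 + i)) 0 = 0.
Proof.
by case: i => [|[|[|]]]//= _; rewrite /A2 !mxrowE/= !eq_o//=; ring.
Qed.

(** The symmetric bilinear form with [S1 (z + v) = S1 z + polarS1 z v + S1 v]. *)
Definition polarS1 (z v : 'cV[R]_9) : R :=
  coord z 7 * coord v 1 + coord v 7 * coord z 1
  + (coord z 8 * coord v 2 + coord v 8 * coord z 2)
  + (coord z 9 * coord v 3 + coord v 9 * coord z 3)
  - (coord z 1 * coord v 1 + coord z 2 * coord v 2 + coord z 3 * coord v 3).

(** Along a line a quadratic function is a polynomial of degree two in the step,
    so the derivative can be read off. Used for [S1] and, with [m = 0], for its
    first derivatives. *)
Lemma derive_quadratic (f : 'cV[R]_9 -> R^o) (z v : 'cV[R]_9) (l m : R) :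
  (forall h : R, f (h *: v + z) - f z = h * l + h ^+ 2 * m) -> 'D_v f z = l.
Proof.
move=> fE; apply: cvg_lim; first exact: Rhausdorff.
apply: (@cvg_trans _ ((fun h : R => l + h * m) @ 0^')).
  apply: near_eq_cvg; near=> h.
  have h0 : h != 0 by near: h; exact: nbhs_dnbhs_neq.
  by rewrite /= fE /GRing.scale/=; field.
have : (l + h * m) @[h --> (0 : R)^'] --> (l + 0 * m).
  apply: cvgD; first exact: cvg_cst.
  by apply: cvgM; [exact: cvg_within|exact: cvg_cst].
by rewrite mul0r addr0.
Unshelve. all: by end_near. Qed.

Lemma derive_S1 (z v : 'cV[R]_9) : 'D_v (S1 : _ -> R^o) z = polarS1 z v.
Proof.
apply: (derive_quadratic (m := S1 v)) => h.
by rewrite /S1 /polarS1 /coord !mxE; field.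
Qed.

Lemma hessS1E (a b : 'I_9) :
  (hessS1 : 'M[R]_9) a b = polarS1 (delta_mx a 0) (delta_mx b 0).
Proof.
rewrite mxE; under eq_fun do rewrite derive_S1.
apply: (derive_quadratic (m := 0)) => h.
by rewrite /polarS1 /coord !mxE; ring.
Qed.

Lemma hessS1_sym : (hessS1 : 'M[R]_9)^T = hessS1.
Proof.
apply/matrixP => a b; rewrite mxE !hessS1E /polarS1; ring.
Qed.

(** The last three components of the gradient of [S1] are [T], [S], [E]. *)
Lemma hessS1_high z i : (i < 3)%N -> (hessS1 *m z) (ord9 (6 + i)) 0 = z (ord9 i) 0.
Proof.
move=> i3; have E d : (hessS1 : 'M[R]_9) (ord9 (6 + i)) d = (ord9 i == d)%:R.
  rewrite hessS1E /polarS1 /coord !mxE/=.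
  by case: i i3 => [|[|[|]]]//= _; rewrite !eq_o//= !andbT; ring.
rewrite mxE (bigD1 (ord9 i))//= big1 ?E ?eqxx ?mul1r ?addr0// => d di.
by rewrite E eq_sym (negbTE di) mul0r.
Qed.

End Matrices.

(** * The bilinear product rule in time *)

Section TimeCore.
Context {R : realType}.
Local Notation mu := (@lebesgue_measure R).

(** On the components 4 to 9, [v] is up to sign a component of [M v], so that
    [M u . v] is a sum of products of indefinite integrals. On the first three
    components [M u] and [M v] vanish identically, hence [al] and [be] vanish
    almost everywhere and adding [v * al - u * be] changes no integral. *)
Lemma primitive_bilinear (T : R) (u v al be : R -> 'cV[R]_9) : 0 <= T ->
  (forall c, primitive T (fun t => (Mmx *m u t) c 0) (fun t => al t c 0)) ->
  (forall c, primitive T (fun t => (Mmx *m v t) c 0) (fun t => be t c 0)) ->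
  (forall i, (i < 3)%N -> measurable_fun `[0, T] (fun t => u t (ord9 i) 0)) ->
  (forall i, (i < 3)%N -> measurable_fun `[0, T] (fun t => v t (ord9 i) 0)) ->
  primitive T (fun t => dotv (Mmx *m u t) (v t))
              (fun t => dotv (al t) (v t) - dotv (be t) (u t)).
Proof.
move=> T0 pu pv mu' mv'.
pose XU n t := (Mmx *m u t) (ord9 n) 0; pose XV n t := (Mmx *m v t) (ord9 n) 0.
have low (w ga : R -> 'cV[R]_9) (f : R -> R) i :
    (forall c, primitive T (fun t => (Mmx *m w t) c 0) (fun t => ga t c 0)) ->
    (i < 3)%N -> measurable_fun `[0, T] f ->
    primitive T (cst 0) (fun t => f t * ga t (ord9 i) 0).
  move=> pw i3 mf; apply: primitive_null => //; first exact: (pw (ord9 i)).1.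
  by apply: primitive_cst_ae0 (pw (ord9 i)) _ => // t _; rewrite !Mmx_low.
have pi i : (i < 3)%N -> primitive T
    (fun t => XV (6 + i)%N t * XU (3 + i)%N t + (-1) * (XV (3 + i)%N t * XU (6 + i)%N t)
              + (cst 0 t + (-1) * cst 0 t))
    (fun t => be t (ord9 (6 + i)) 0 * XU (3 + i)%N t
      + al t (ord9 (3 + i)) 0 * XV (6 + i)%N t
      + (-1) * (be t (ord9 (3 + i)) 0 * XU (6 + i)%N t
                + al t (ord9 (6 + i)) 0 * XV (3 + i)%N t)
      + (v t (ord9 i) 0 * al t (ord9 i) 0 + (-1) * (u t (ord9 i) 0 * be t (ord9 i) 0))).
  move=> i3; apply: primitiveD; apply: primitiveD.
  - exact: (primitiveM T0 (pv (ord9 (6 + i))) (pu (ord9 (3 + i)))).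
  - by apply: primitiveZ; exact: (primitiveM T0 (pv (ord9 (3 + i))) (pu (ord9 (6 + i)))).
  - by apply: low => //; exact: mv'.
  - by apply: primitiveZ; apply: low => //; exact: mu'.
(* pi pairs component i + 4 with i + 7; its two null terms, from component
   i + 1, only contribute to the integrand. *)
have := primitiveD (primitiveD (pi 0 isT) (pi 1 isT)) (pi 2 isT).
apply: eq_primitive => // t _; rewrite /dotv !sum9 /XU /XV.
- rewrite (@Mmx_low _ _ 0)// (@Mmx_low _ _ 1)// (@Mmx_low _ _ 2)//.
  rewrite !(@Mmx_mid _ _ 0)// !(@Mmx_mid _ _ 1)// !(@Mmx_mid _ _ 2)//.
  rewrite !(@Mmx_high _ _ 0)// !(@Mmx_high _ _ 1)// !(@Mmx_high _ _ 2)//=.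
  by rewrite /cst; ring.
- rewrite !(@Mmx_mid _ _ 0)// !(@Mmx_mid _ _ 1)// !(@Mmx_mid _ _ 2)//.
  rewrite !(@Mmx_high _ _ 0)// !(@Mmx_high _ _ 1)// !(@Mmx_high _ _ 2)//=.
  ring.
Qed.

End TimeCore.

(** * Expansion of the solutions in time-independent test functions *)

Section Expansion.
Context {R : realType}.
Local Notation mu := (@lebesgue_measure R).
Context (gx gy : grid R) (k : nat) (i j : nat).
Context (hi : (i < ncells gx)%N) (hj : (j < ncells gy)%N).
Implicit Types (U V Z : R -> R -> 'cV[R]_9).

Lemma Vh9_grid_poly Z : Vh9 gx gy k Z -> grid_poly gx gy Z.
Proof.
move=> hZ i' j' hi' hj' c; have [r [p [q [_ _ Zpq]]]] := hZ c i' j' hi' hj'.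
exists [seq (p l, q l) | l <- enum 'I_r] => x y xi yj.
by rewrite Zpq ?cell_intE// /tensor_sum big_map big_enum.
Qed.

Lemma grid_poly_swap Z : grid_poly gx gy Z -> grid_poly gy gx (fun y x => Z x y).
Proof. by move=> gZ j' i' hj' hi' c; apply: cell_poly_swap; exact: gZ. Qed.

Context (e f : nat -> {poly R}).
Local Notation xl := (node gx i).
Local Notation xr := (node gx i.+1).
Local Notation yl := (node gy j).
Local Notation yr := (node gy j.+1).
Context (se : forall a, (size (e a) <= a.+1)%N).
Context (sf : forall a, (size (f a) <= a.+1)%N).
Context (ee : forall p : {poly R}, (size p <= k.+1)%N ->
  p = \sum_(a < k.+1) poly_int xl xr (p * e a) *: e a).
Context (ff : forall p : {poly R}, (size p <= k.+1)%N ->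
  p = \sum_(a < k.+1) poly_int yl yr (p * f a) *: f a).

Local Notation idx := ('I_k.+1 * 'I_k.+1)%type.

Definition basis_fun (ab : idx) (x y : R) : R := (e ab.1).[x] * (f ab.2).[y].

Definition basis_vec (n : 'I_9 * idx) (x y : R) : 'cV[R]_9 :=
  basis_fun n.2 x y *: delta_mx n.1 0.

(** The coefficients of [Z] in the orthonormal basis, collected in a column for
    each scalar basis function. *)
Definition moment Z (ab : idx) : 'cV[R]_9 :=
  \col_c cell_integral gx gy (fun x y => Z x y c 0 * basis_fun ab x y) i j.

Lemma basis_vec_Vh9 n : Vh9 gx gy k (basis_vec n).
Proof.
case: n => c [a b] d i' j' hi' hj'.
exists 1%N, (fun=> (d == c)%:R *: e a), (fun=> f b); split.
- by move=> _; rewrite (leq_trans (size_scale_leq _ _))// (leq_trans (se _)).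
- by move=> _; rewrite (leq_trans (sf _)).
- move=> x y _ _; rewrite big_ord1 /basis_vec /basis_fun !mxE/= hornerZ andbT.
  by rewrite mulrC mulrA.
Qed.

Lemma Vh_expand (v : R -> R -> R) : Vh gx gy k v ->
  forall x y, in_cell gx i x -> in_cell gy j y ->
  v x y = \sum_ab cell_integral gx gy (fun x y => v x y * basis_fun ab x y) i j
                 * basis_fun ab x y.
Proof.
move=> hv; have [r [p [q [sp sq vpq]]]] := hv i j hi hj.
have cE ab : cell_integral gx gy (fun x y => v x y * basis_fun ab x y) i j =
    \sum_(l < r) poly_int xl xr (p l * e ab.1) * poly_int yl yr (q l * f ab.2).
  rewrite (cell_integral_tensor
    (s := [seq (p l * e ab.1, q l * f ab.2) | l <- enum 'I_r]))//.
    by rewrite big_map big_enum.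
  move=> x y xi yj; rewrite vpq ?cell_intE// /tensor_sum big_map big_enum mulr_suml.
  by apply: eq_bigr => l _ /=; rewrite !hornerM /basis_fun mulrACA.
move=> x y xi yj; rewrite vpq ?cell_intE//.
under [RHS]eq_bigr do rewrite cE mulr_suml.
rewrite exchange_big/=; apply: eq_bigr => l _.
rewrite {1}(ee (sp l)) {1}(ff (sq l)) !horner_sum mulr_suml.
under [LHS]eq_bigr do rewrite mulr_sumr.
rewrite pair_big/=; apply: eq_bigr => ab _.
by rewrite !hornerZ /basis_fun mulrACA.
Qed.

Lemma Vh9_expand Z : Vh9 gx gy k Z ->
  forall x y, in_cell gx i x -> in_cell gy j y ->
  Z x y = \sum_n moment Z n.2 n.1 0 *: basis_vec n x y.
Proof.
move=> hZ x y xi yj; apply/matrixP => c d; rewrite ord1 (Vh_expand (hZ c) xi yj).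
rewrite -(pair_bigA _ (fun c ab => moment Z ab c 0 *: basis_vec (c, ab) x y))/=.
rewrite summxE (bigD1 c)//= [X in _ + X]big1 ?addr0 => [|c' c'c].
  rewrite summxE; apply: eq_bigr => ab _.
  by rewrite /moment /basis_vec !mxE !eqxx mulr1.
rewrite summxE big1// => ab _.
by rewrite /basis_vec !mxE eq_sym (negbTE c'c) !mulr0.
Qed.

Lemma cell_integral_basis_vec K Z n : grid_poly gx gy Z ->
  cell_integral gx gy (fun x y => dotv (K *m Z x y) (basis_vec n x y)) i j =
  (K *m moment Z n.2) n.1 0.
Proof.
move=> gZ; rewrite (cell_integral_sum (c := fun d => K n.1 d)
  (F := fun d x y => Z x y d 0 * basis_fun n.2 x y) hi hj).
- by rewrite mxE; apply: eq_bigr => d _; rewrite mxE.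
- by move=> d; apply: cell_poly_mul; [exact: gZ|exact: cell_poly_tensor].
- move=> x y _ _; rewrite /basis_vec dotv_delta mxE mulr_sumr.
  by apply: eq_bigr => d _; rewrite mulrC mulrA.
Qed.

Context (m1 n1 m2 n2 : R).

(** The right-hand side of the variational equation on the cell. *)
Definition scheme_terms Z phi : R :=
  x_terms gx gy (A1 m1 n1) Z phi i j
  + y_terms gx gy (A2 m2 n2) Z phi i j
  + cell_integral gx gy (fun x y => dotv (hessS1 *m Z x y) (phi x y)) i j.

Lemma x_termsE A Z phi : x_terms gx gy A Z phi i j = dir_terms gx gy K1 A Z phi i j.
Proof. by []. Qed.

Lemma y_termsE A Z phi : y_terms gx gy A Z phi i j =
  dir_terms gy gx K2 A (fun y x => Z x y) (fun y x => phi x y) j i.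
Proof. by []. Qed.

(** Linearity in the test function. The basis functions are global polynomials
    and agree with [V] only inside the cell, which is all that the terms of
    the scheme on that cell depend on. *)
Lemma scheme_terms_expand Z V : Vh9 gx gy k Z -> Vh9 gx gy k V ->
  scheme_terms Z V = \sum_n moment V n.2 n.1 0 * scheme_terms Z (basis_vec n).
Proof.
move=> /Vh9_grid_poly gZ hV; have VE := Vh9_expand hV.
have bv n := Vh9_grid_poly (basis_vec_Vh9 n) hi hj.
rewrite /scheme_terms x_termsE y_termsE.
rewrite (dir_terms_sum K1 _ gZ hi hj bv VE).
rewrite (dir_terms_sum (psi := fun n y x => basis_vec n x y)
  (a := fun n => moment V n.2 n.1 0) K2 _ (grid_poly_swap gZ) hj hi); first last.
- by move=> y x yj xi; exact: VE.
- by move=> n c; apply: cell_poly_swap; exact: bv.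
rewrite (cell_integral_sum (c := fun n => moment V n.2 n.1 0)
  (F := fun n x y => dotv (hessS1 *m Z x y) (basis_vec n x y)) hi hj); first last.
- by move=> x y xi yj; rewrite VE// dotv_sumr; apply: eq_bigr => n _; rewrite dotvZr.
- by move=> n; apply: cell_poly_dotv => //; apply: cell_vpoly_mulmx; exact: gZ.
rewrite -big_split -big_split; apply: eq_bigr => n _ /=.
by rewrite [RHS]mulrDr [X in _ = X + _]mulrDr x_termsE y_termsE.
Qed.

(** The conservation law at a fixed time and path. *)
Lemma scheme_terms_skew U V : Vh9 gx gy k U -> Vh9 gx gy k V ->
  x_flux_balance gx gy (A1 m1 n1) U V i j + y_flux_balance gx gy (A2 m2 n2) U V i j
  = scheme_terms U V - scheme_terms V U.
Proof.
move=> /Vh9_grid_poly gU /Vh9_grid_poly gV.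
rewrite /x_flux_balance /y_flux_balance /scheme_terms !x_termsE !y_termsE.
rewrite (dir_terms_skew K1_skew (A1_sym _ _) gU gV hi hj).
rewrite (dir_terms_skew K2_skew (A2_sym _ _) (grid_poly_swap gU)
  (grid_poly_swap gV) hj hi).
have -> : (fun x y => dotv (hessS1 *m U x y) (V x y)) =
          (fun x y => dotv (hessS1 *m V x y) (U x y)).
  by apply/funext => x; apply/funext => y; exact: dotv_sym hessS1_sym.
move: (cell_integral _ _ _ _ _) => h.
move: (dir_terms gx gy K1 _ U V i j) (dir_terms gx gy K1 _ V U i j) => xuv xvu.
move: (dir_terms gy gx K2 _ _ _ _ _) (dir_terms gy gx K2 _ _ _ _ _) => yuv yvu.
by ring.
Qed.

(** Rows 7, 8, 9 of the scheme express the moments of the first three components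
    as right-hand sides, which are integrable, hence measurable, in time. *)
Lemma scheme_terms_high Z l ab : Vh9 gx gy k Z -> (l < 3)%N ->
  scheme_terms Z (basis_vec (ord9 (6 + l), ab)) = moment Z ab (ord9 l) 0.
Proof.
move=> /Vh9_grid_poly gZ l3; rewrite /scheme_terms cell_integral_basis_vec//=.
rewrite hessS1_high// x_termsE y_termsE.
rewrite (dir_terms_null hi hj gZ (cell_poly_tensor _ _ _ _ _ _)); first last.
- by move=> z; rewrite A1_high.
- by move=> z; rewrite K1_high.
rewrite (dir_terms_null hj hi (grid_poly_swap gZ)
  (cell_poly_swap (cell_poly_tensor _ _ _ _ _ _))) ?add0r//.
- by move=> z; rewrite K2_high.
- by move=> z; rewrite A2_high.
Qed.

End Expansion.

Theorem theorem3p4 (R : realType) (d : measure_display) (Om : measurableType d)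
    (P : probability Om R) (Tf : R) (hTf : 0 < Tf)
    (gx gy : grid R) (k : nat)
    (alpha1 alpha2 m1 n1 m2 n2 : R)
    (halpha1 : m1 - n1 = alpha1) (halpha2 : m2 - n2 = alpha2)
    (U V : R -> Om -> R -> R -> 'cV[R]_9)
    (hU : variational_solution P Tf gx gy k m1 n1 m2 n2 U)
    (hV : variational_solution P Tf gx gy k m1 n1 m2 n2 V)
    (i j : nat) (hi : (i < ncells gx)%N) (hj : (j < ncells gy)%N) :
  multisymplectic_conservation P Tf gx gy m1 n1 m2 n2 U V i j.
Proof.
have T0 := ltW hTf.
have [e [se _ ee]] := orthonormal_basis k.+1 (node_lt hi).
have [f [sf _ ff]] := orthonormal_basis k.+1 (node_lt hj).
pose sol (Z : R -> Om -> R -> R -> 'cV[R]_9) w := forall n,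
  primitive Tf (fun t => (Mmx *m moment gx gy i j e f (Z t w) n.2) n.1 0)
    (fun t => scheme_terms gx gy i j m1 n1 m2 n2 (Z t w) (basis_vec (k := k) e f n)).
have aeF : Filter (almost_everywhere P) := ae_filter_ringOfSetsType P.
have solP Z : variational_solution P Tf gx gy k m1 n1 m2 n2 Z ->
    {ae P, forall w, sol Z w}.
  (* The index set of the basis is finite: one null set serves all its members. *)
  move=> [hZ Zeq]; apply: filter_forall => n.
  apply: filterS (Zeq i j hi hj _ (basis_vec_Vh9 se sf n)) => w.
  apply: eq_primitive => // t; rewrite in_itv/= => tT.
  by rewrite cell_integral_basis_vec//; exact: Vh9_grid_poly (hZ t w tT).
apply: filterS2 (solP U hU) (solP V hV) => w sU sV.
have hUt t : t \in `[0, Tf] -> Vh9 gx gy k (U t w).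
  by rewrite in_itv/=; exact: hU.1.
have hVt t : t \in `[0, Tf] -> Vh9 gx gy k (V t w).
  by rewrite in_itv/=; exact: hV.1.
pose al (Z : R -> Om -> R -> R -> 'cV[R]_9) ab t : 'cV[R]_9 :=
  \col_c scheme_terms gx gy i j m1 n1 m2 n2 (Z t w) (basis_vec (k := k) e f (c, ab)).
have meas (Z : R -> Om -> R -> R -> 'cV[R]_9) (ab : 'I_k.+1 * 'I_k.+1) l :
    (forall t, t \in `[0, Tf] -> Vh9 gx gy k (Z t w)) -> sol Z w -> (l < 3)%N ->
    measurable_fun `[0, Tf] (fun t => moment gx gy i j e f (Z t w) ab (ord9 l) 0).
  move=> hZt sZ l3; have [Ia _] := sZ (ord9 (6 + l), ab).
  have ma := (measurable_EFinP _ _).1 (measurable_int _ Ia).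
  apply: eq_measurable_fun ma => t /set_mem tT.
  by rewrite scheme_terms_high//; exact: hZt.
have pal (Z : R -> Om -> R -> R -> 'cV[R]_9) : sol Z w -> forall ab c,
    primitive Tf (fun t => (Mmx *m moment gx gy i j e f (Z t w) ab) c 0)
                 (fun t => al Z ab t c 0).
  move=> sZ ab c; apply: eq_primitive (sZ (c, ab)) => // t _.
  by rewrite /al mxE.
have := primitive_sum (index_enum _) T0 (fun ab => primitive_bilinear T0
  (pal U sU ab) (pal V sV ab)
  (fun l l3 => meas U ab l hUt sU l3) (fun l l3 => meas V ab l hVt sV l3)).
apply: eq_primitive => // t tT; have [hUw hVw] := (hUt t tT, hVt t tT).
  rewrite (cell_integral_sum (c := fun n => moment gx gy i j e f (V t w) n.2 n.1 0)
    (F := fun n x y => dotv (Mmx *m U t w x y) (basis_vec (k := k) e f n x y)) hi hj).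
  - rewrite (eq_bigr (fun n => moment gx gy i j e f (V t w) n.2 n.1 0 *
      (Mmx *m moment gx gy i j e f (U t w) n.2) n.1 0)) => [|n _]; last first.
      by rewrite cell_integral_basis_vec//; exact: Vh9_grid_poly hUw.
    rewrite -(pair_bigA _ (fun c ab => moment gx gy i j e f (V t w) ab c 0 *
      (Mmx *m moment gx gy i j e f (U t w) ab) c 0))/= exchange_big.
    by apply: eq_bigr => ab _; apply: eq_bigr => c _ /=; rewrite mulrC.
  - move=> n; apply: cell_poly_dotv.
      by apply: cell_vpoly_mulmx; exact: Vh9_grid_poly hUw _ _ hi hj.
    exact: Vh9_grid_poly (basis_vec_Vh9 se sf n) _ _ hi hj.
  - move=> x y xi yj; rewrite (Vh9_expand hi hj ee ff hVw xi yj) dotv_sumr.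
    by apply: eq_bigr => n _; rewrite dotvZr.
rewrite (scheme_terms_skew hi hj _ _ _ _ hUw hVw).
rewrite (scheme_terms_expand hi hj se sf ee ff _ _ _ _ hUw hVw).
rewrite (scheme_terms_expand hi hj se sf ee ff _ _ _ _ hVw hUw).
rewrite sumrB; congr (_ - _); rewrite [LHS]exchange_big/= pair_bigA/=;
  by apply: eq_bigr => -[c ab] _; rewrite mxE mulrC.
Qed.
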